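(* Let $X$ be a non-empty set, and let $B$ be the free object on $X$ in the category of commutative skew braces. Then the multiplicative group $(B,\circ)$ is free abelian.
   Context: A (left) skew brace is a triple $(B,+,\circ)$ with $(B,+)$ and $(B,\circ)$ groups such that $a\circ(b+c)=a\circ b-a+a\circ c$ for all $a,b,c$. It is called commutative if $(B,\circ)$ is abelian ($(B,+)$ need not be abelian). Homomorphisms preserve both operations. The free object on $X$ is a commutative skew brace $B$ with a map $i\colon X\to B$ such that each map from $X$ to a commutative skew brace $K$ factors as $\varphi\circ i$ for a unique homomorphism $\varphi\colon B\to K$; it exists. *)

(* Defs.v *)
From mathcomp Require Import all_boot all_algebra.
From mathcomp.multinomials Require Import freeg.

Set Implicit Arguments.
Unset Strict Implicit.
Unset Printing Implicit Defensive.

(* The carriers are plain types rather than choiceTypes, which MathComp's     *)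
(* groupType would impose, and the additive group need not be abelian, so     *)
(* zmodType does not apply either.                                            *)
Record is_group (T : Type) (op : T -> T -> T) (e : T) (inv : T -> T) : Prop :=
  IsGroup {
    group_assoc : associative op;
    group_left_id : left_id e op;
    group_right_id : right_id e op;
    group_left_inv : left_inverse e inv op;
    group_right_inv : right_inverse e inv op
  }.

Record skew_brace : Type := SkewBrace {
  carrier :> Type;
  sb_add : carrier -> carrier -> carrier;
  sb_zero : carrier;
  sb_opp : carrier -> carrier;
  sb_circ : carrier -> carrier -> carrier;
  sb_one : carrier;
  sb_inv : carrier -> carrier;
  sb_add_group : is_group sb_add sb_zero sb_opp;
  sb_circ_group : is_group sb_circ sb_one sb_inv;
  sb_compat : forall a b c : carrier,
    sb_circ a (sb_add b c) =
    sb_add (sb_add (sb_circ a b) (sb_opp a)) (sb_circ a c)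
}.

Arguments sb_add {_} _ _.
Arguments sb_zero {_}.
Arguments sb_opp {_} _.
Arguments sb_circ {_} _ _.
Arguments sb_one {_}.
Arguments sb_inv {_} _.

Definition commutative_skew_brace (B : skew_brace) : Prop :=
  commutative (@sb_circ B).

Definition skew_brace_hom (B K : skew_brace) (f : B -> K) : Prop :=
  {morph f : a b / sb_add a b} /\ {morph f : a b / sb_circ a b}.

Definition free_commutative_skew_brace
    (X : Type) (B : skew_brace) (i : X -> B) : Prop :=
  commutative_skew_brace B /\
  forall K : skew_brace, commutative_skew_brace K ->
  forall f : X -> K,
    exists phi : B -> K,
      [/\ skew_brace_hom phi,
          f =1 phi \o i
        & forall psi : B -> K,
            skew_brace_hom psi -> f =1 psi \o i -> psi =1 phi].

(* {freeg S / int} is the group of finitely supported functions from S to the *)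
(* integers, i.e. the free abelian group on S. The rank may be zero or        *)
(* infinite.                                                                  *)
Definition free_abelian (T : Type) (op : T -> T -> T) : Prop :=
  exists (S : choiceType) (f : {freeg S / int} -> T),
    bijective f /\ {morph f : u v / GRing.add u v >-> op u v}.

(* Main.v *)
Require Import Defs.
From HB Require Import structures.
From mathcomp Require Import all_boot all_algebra.
From mathcomp Require Import generic_quotient finmap boolp wochoice ring.
From mathcomp.multinomials Require Import monalg freeg.

(* Let s(a,b) = a o b - b - a and let M be the additive group generated by    *)
(* all s(a,b). Expanding (a + b) o (c + d) in two ways shows that M is        *)
(* abelian; B/M is the free abelian group on X, with + and o equal. On M act  *)
(* the commuting operators rho_a k = k o a - a and c_a k = a + k - a, and the *)
(* associativity of o gives                                                   *)
(*   (rho_a - 1) s(c,b) = (rho_b - 1) s(c,a),                                 *)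
(*   (rho_a - c_a) s(b,c) = (rho_b - c_b) s(a,c).                             *)
(* So s(a,b) behaves like the product (rho_a - c_a)(rho_b - 1), and M like an *)
(* ideal of a localized polynomial ring in variables r_x = rho_x - 1 and      *)
(* q_x = rho_x - c_x. To make this precise, let F be the fraction field of    *)
(* Z[r_x, q_x]. The pairs (p,c) of elements of F(t) that are units with value *)
(* 1 at t = 0 form a commutative skew brace: o is componentwise, and + is the *)
(* composition of the affine maps z |-> (p - 1) + c z. By freeness there is a *)
(* homomorphism sending x to (1 + t r_x, 1 + t (r_x - q_x)); clearing         *)
(* denominators, the two relations above show that it is injective on M.      *)
(* Hence (B,o) embeds in the product of Z^X with the multiplicative group of  *)
(* rational functions with value 1 at 0; the latter embeds in the free        *)
(* abelian group on the monic irreducible polynomials of F[t], and subgroups  *)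
(* of free abelian groups are free.                                           *)

Set Implicit Arguments.
Unset Strict Implicit.
Unset Printing Implicit Defensive.
Import Num.Theory GRing.Theory.
Local Open Scope ring_scope.
Local Open Scope quotient_scope.

(** * The additive group generated by the elements a o b - b - a *)

(** It suffices to embed (B,o) in a free abelian group, because subgroups of free abelian groups are
    free ([subgroup_free_abelian], by leading coefficients along a well-order). The embedding has
    two coordinates. [degree_exists] gives a homomorphism to Z^X whose kernel lies in M.
    [free_rational_map] gives a multiplicative map to rational functions with value 1 at 0 that
    takes the value 1 on no nonzero element of M; [unit_at0_free] embeds these functions in a free
    abelian group by recording the exponents of their prime factors.

    The hard point is injectivity on M. Since M is abelian ([in_starsC]), it is a faithful module
    over the commutative ring generated by the rho_a and c_a ([commuting_operators]). The relations
    [starM_swapr] and [starM_swapl] are those satisfied by the products q_a r_b, so [rank_one_map]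
    sends q_x r_y to s(x,y). By [linked_eq0], an element of M and its rational function are
    represented by one fraction p/d whose denominator acts injectively on M; if the function
    vanishes then p = 0, and the element is zero. *)

Section BraceCalculus.
Variables (B : skew_brace) (hB : commutative_skew_brace B).
Implicit Types a b c : B.

Local Notation "x <+> y" := (sb_add x y) (at level 50, left associativity).
Local Notation "x <o> y" := (sb_circ x y) (at level 40, left associativity).
Local Notation "<-> x" := (sb_opp x) (at level 35, right associativity).
Local Notation zero := (@sb_zero B).

Let addA a b c : (a <+> b) <+> c = a <+> (b <+> c).
Proof. by rewrite (group_assoc (sb_add_group B)). Qed.
Let add0 a : zero <+> a = a. Proof. exact: (group_left_id (sb_add_group B)). Qed.
Let addr0 a : a <+> zero = a. Proof. exact: (group_right_id (sb_add_group B)). Qed.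
Let addN a : <-> a <+> a = zero. Proof. exact: (group_left_inv (sb_add_group B)). Qed.
Let addrN a : a <+> <-> a = zero. Proof. exact: (group_right_inv (sb_add_group B)). Qed.
Let addNK a b : <-> a <+> (a <+> b) = b. Proof. by rewrite -addA addN add0. Qed.
Let addKN a b : a <+> (<-> a <+> b) = b. Proof. by rewrite -addA addrN add0. Qed.
Let addI a b c : a <+> b = a <+> c -> b = c.
Proof. by move=> /(congr1 (sb_add (<-> a))); rewrite !addNK. Qed.
Let opp0 : <-> zero = zero. Proof. by rewrite -[LHS]add0 addrN. Qed.
Let oppK a : <-> <-> a = a.
Proof. by apply: (@addI (<-> a)); rewrite addN addrN. Qed.
Let oppD a b : <-> (a <+> b) = <-> b <+> <-> a.
Proof. by apply: (@addI (a <+> b)); rewrite addrN addA addKN addrN. Qed.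
Let gs := (addA, add0, addr0, addN, addrN, addNK, addKN, opp0, oppK, oppD).

Let circC a b : a <o> b = b <o> a. Proof. exact: hB. Qed.
Let circA a b c : (a <o> b) <o> c = a <o> (b <o> c).
Proof. by rewrite (group_assoc (sb_circ_group B)). Qed.
Let circDr a b c : a <o> (b <+> c) = a <o> b <+> <-> a <+> a <o> c.
Proof. exact: sb_compat. Qed.
Let circDl a b c : (a <+> b) <o> c = a <o> c <+> <-> c <+> b <o> c.
Proof. by rewrite circC circDr !(circC c). Qed.

Let circ0 a : a <o> zero = a.
Proof.
have := circDr a zero zero; rewrite add0 addA -[in LHS](addr0 (a <o> zero)).
by move=> /addI/(congr1 (sb_add a)); rewrite !gs => <-.
Qed.

Lemma sb_one_zero : @sb_one B = zero.
Proof. by rewrite -(circ0 sb_one) (group_left_id (sb_circ_group B)). Qed.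

Definition star a b : B := a <o> b <+> <-> b <+> <-> a.

Let circE a b : a <o> b = star a b <+> a <+> b.
Proof. by rewrite /star !gs. Qed.

Let starDl a a' b :
  star (a <+> a') b = star a b <+> (a <+> star a' b <+> <-> a).
Proof. by rewrite /star circDl !gs. Qed.

Let starDr a b b' : star a (b <+> b') =
  star a b <+> ((a <+> b <+> <-> a) <+> star a b' <+> <-> (a <+> b <+> <-> a)).
Proof. by rewrite /star circDr !gs. Qed.

Inductive in_stars : B -> Prop :=
| in_stars0 : in_stars zero
| in_stars_star a b : in_stars (star a b)
| in_starsD m m' : in_stars m -> in_stars m' -> in_stars (m <+> m')
| in_starsN m : in_stars m -> in_stars (<-> m).

(** Solving the expansion of [star (a <+> a') b] for its last term writes the conjugate of a
    generator through generators, so M is normal in (B,+). *)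
Lemma in_starsJ a (m : B) : in_stars m -> in_stars (a <+> m <+> <-> a).
Proof.
elim=> [|a' b|x y _ IHx _ IHy|x _ IHx].
- by rewrite !gs; constructor.
- have -> : a <+> star a' b <+> <-> a = <-> star a b <+> star (a <+> a') b.
    by rewrite starDl !gs.
  by do !constructor.
- have -> : a <+> (x <+> y) <+> <-> a =
    (a <+> x <+> <-> a) <+> (a <+> y <+> <-> a) by rewrite !gs.
  exact: in_starsD.
have -> : a <+> <-> x <+> <-> a = <-> (a <+> x <+> <-> a) by rewrite !gs.
exact: in_starsN.
Qed.

(* Expanding [(a + b) o (c + d)] with either factor distributed first. *)
Let lstar_comm a b c d :
  (<-> a <+> a <o> d <+> <-> d) <+> (<-> c <+> c <o> b <+> <-> b) =
  (<-> c <+> c <o> b <+> <-> b) <+> (<-> a <+> a <o> d <+> <-> d).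
Proof.
have := circDl a b (c <+> d); rewrite circDr (circDl a b c) (circDl a b d).
rewrite !circDr !gs => /addI; rewrite !(circC b c).
set x := a <o> d; set y := c <o> b; set z := b <o> d => E.
have {}E : (<-> c <+> y <+> <-> b <+> (<-> a <+> x <+> <-> d)) <+> z =
  (<-> a <+> x <+> <-> d <+> (<-> c <+> y <+> <-> b)) <+> z by rewrite !gs.
by move: E => /(congr1 (fun t => t <+> <-> z)); rewrite !gs.
Qed.

Let commD (x y m : B) : x <+> m = m <+> x -> y <+> m = m <+> y ->
  (x <+> y) <+> m = m <+> (x <+> y).
Proof. by move=> xm ym; rewrite addA ym -addA xm addA. Qed.

Let commN (x m : B) : x <+> m = m <+> x -> <-> x <+> m = m <+> <-> x.
Proof. by move=> xm; apply: (@addI x); rewrite addKN -addA xm !gs. Qed.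

(** Both terms on the right have, up to sign, the form [<-> x <+> x <o> y <+> <-> y] covered by
    [lstar_comm]; this transfers commutation to the stars themselves. *)
Let starE a b : star a b =
  <-> (<-> a <+> a <o> a <+> <-> a) <+>
  (<-> a <+> a <o> (a <+> b) <+> <-> (a <+> b)).
Proof. by rewrite /star circDr !gs. Qed.

Lemma in_starsC (m m' : B) : in_stars m -> in_stars m' -> m <+> m' = m' <+> m.
Proof.
move=> Sm Sm'; elim: Sm => [|a b|x y _ IHx _ IHy|x _ IHx].
- by rewrite !gs.
- elim: Sm' => [|c d|x y _ IHx _ IHy|x _ IHx].
  + by rewrite !gs.
  + have C (u v w t : B) : (<-> u <+> u <o> v <+> <-> v) <+>
        (<-> w <+> w <o> t <+> <-> t) =
      (<-> w <+> w <o> t <+> <-> t) <+> (<-> u <+> u <o> v <+> <-> v).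
      exact: lstar_comm.
    rewrite (starE a b) (starE c d).
    by apply: commD; [apply: commN|]; apply/esym/commD; do ?apply: commN.
  + by apply/esym/commD; apply/esym.
  + by apply/esym/commN.
- exact: commD.
- exact: commN.
Qed.


Let circNl a b : (<-> a) <o> b = b <+> <-> (a <o> b) <+> b.
Proof.
apply: (@addI (a <o> b <+> <-> b)).
by rewrite -(circDl a (<-> a) b) addrN circC circ0 !gs.
Qed.

(* The hypothesis is a dummy argument so that the zmodule structure, whose    *)
(* commutativity depends on it, can be inferred from the type.                *)
Definition star_module (_ : commutative_skew_brace B) : Type :=
  {m : {classic B} | `[< in_stars m >]}.

Local Notation M := (star_module hB).
Implicit Types m : M.

HB.instance Definition _ := Choice.on M.

Definition mk_star (m : B) (Sm : in_stars m) : M :=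
  exist _ (m : {classic B}) (introT (asboolP _) Sm).

Definition star_val (m : M) : B := sval m.

Lemma star_valP (m : M) : in_stars (star_val m).
Proof. by case: m => m /= /asboolP. Qed.

Lemma star_val_inj : injective star_val.
Proof. exact: val_inj. Qed.

Definition star_add (m m' : M) : M :=
  mk_star (in_starsD (star_valP m) (star_valP m')).
Definition star_opp (m : M) : M := mk_star (in_starsN (star_valP m)).
Definition star_zero : M := mk_star in_stars0.

Fact star_addA : associative star_add.
Proof. by move=> x y z; apply: star_val_inj; rewrite /= !gs. Qed.
Fact star_addC : commutative star_add.
Proof.
by move=> x y; apply: star_val_inj => /=; apply: in_starsC; apply: star_valP.
Qed.
Fact star_add0 : left_id star_zero star_add.
Proof. by move=> x; apply: star_val_inj; rewrite /= !gs. Qed.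
Fact star_addN : left_inverse star_zero star_opp star_add.
Proof. by move=> x; apply: star_val_inj; rewrite /= !gs. Qed.

HB.instance Definition _ :=
  GRing.isZmodule.Build M star_addA star_addC star_add0 star_addN.

Lemma star_val0 : star_val 0 = zero. Proof. by []. Qed.
Lemma star_valD (x y : M) : star_val (x + y) = star_val x <+> star_val y.
Proof. by []. Qed.
Lemma star_valN (x : M) : star_val (- x) = <-> star_val x.
Proof. by []. Qed.

Definition starM a b : M := mk_star (in_stars_star a b).

Fact in_stars_rho a (m : B) : in_stars m -> in_stars (m <o> a <+> <-> a).
Proof.
move=> Sm; have -> : m <o> a <+> <-> a = star m a <+> m by rewrite /star !gs.
by do !constructor.
Qed.

Definition rho a (m : M) : M := mk_star (in_stars_rho a (star_valP m)).
Definition cj a (m : M) : M := mk_star (in_starsJ a (star_valP m)).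

Let rhoE a m : star_val (rho a m) = star_val m <o> a <+> <-> a.
Proof. by []. Qed.
Let cjE a m : star_val (cj a m) = a <+> star_val m <+> <-> a.
Proof. by []. Qed.
Let sME a b : star_val (starM a b) = star a b.
Proof. by []. Qed.
Let vE := (star_val0, star_valD, star_valN, rhoE, cjE, sME).

Lemma rhoB a : {morph rho a : x y / x - y}.
Proof.
by move=> x y; apply: star_val_inj; rewrite !vE circDl circNl !gs.
Qed.

Lemma cjB a : {morph cj a : x y / x - y}.
Proof. by move=> x y; apply: star_val_inj; rewrite !vE !gs. Qed.

Lemma cjD a b m : cj (a <+> b) m = cj a (cj b m).
Proof. by apply: star_val_inj; rewrite !vE !gs. Qed.

Let cj_stars a m : in_stars a -> cj a m = m.
Proof.
move=> Sa; apply: star_val_inj; rewrite !vE.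
by rewrite (in_starsC Sa (star_valP m)) !gs.
Qed.

(** The elements [a <o> b] and [a <+> b] differ by [star a b], and the abelian group M acts
    trivially on itself by conjugation. Commutativity of o then makes all conjugations commute on
    M. *)
Lemma cj_circ a b m : cj (a <o> b) m = cj a (cj b m).
Proof. by rewrite circE (cjD _ b) (cjD _ a) cj_stars //; constructor. Qed.

Lemma cj_comm a b m : cj a (cj b m) = cj b (cj a m).
Proof. by rewrite -!cj_circ circC. Qed.

Lemma cj0 m : cj zero m = m.
Proof. by apply: cj_stars; constructor. Qed.

Lemma cjN a m : cj (<-> a) (cj a m) = m.
Proof. by rewrite -cjD addN cj0. Qed.

Lemma rhoD a b m : rho (a <+> b) m = rho a m - cj a m + cj a (rho b m).
Proof. by apply: star_val_inj; rewrite !vE circDr !gs. Qed.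

Lemma rho_circ a b m : rho (a <o> b) m = rho b (rho a m).
Proof.
by apply: star_val_inj; rewrite !vE circDl circNl circA !gs.
Qed.

Lemma rho_comm a b m : rho a (rho b m) = rho b (rho a m).
Proof. by rewrite -!rho_circ circC. Qed.

Lemma rho0 m : rho zero m = m.
Proof. by apply: star_val_inj; rewrite !vE circ0 !gs. Qed.

(** The two sides differ by conjugation by [star b a], which is trivial on M. *)
Lemma rho_cj a b m : rho a (cj b m) = cj b (rho a m).
Proof.
transitivity (cj (star b a) (cj b (rho a m))); last first.
  by apply: cj_stars; constructor.
rewrite -cjD; apply: star_val_inj.
by rewrite !vE !circDl circNl /star !gs.
Qed.

Lemma starMDl a a' b : starM (a <+> a') b = starM a b + cj a (starM a' b).
Proof. by apply: star_val_inj; rewrite !vE starDl. Qed.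

Lemma starMDr a b b' : starM a (b <+> b') = starM a b + cj b (starM a b').
Proof.
transitivity (starM a b + cj (a <+> b <+> <-> a) (starM a b')).
  by apply: star_val_inj; rewrite !vE starDr.
by rewrite !cjD (cj_comm a) (cj_comm a) cjN.
Qed.

(** With [starM_valr], this turns a star with one argument in M into an operator applied to that
    argument, so nested stars become operator expressions. *)
Lemma starM_vall (m : M) a : starM (star_val m) a = rho a m - m.
Proof. by apply: star_val_inj; rewrite !vE. Qed.

Lemma starM_valr a (m : M) : starM a (star_val m) = rho a m - cj a m.
Proof. by apply: star_val_inj; rewrite !vE /star circC !gs. Qed.

Let starM_circl a a' b : starM (a <o> a') b =
  rho b (starM a a') - starM a a' + starM a b + cj a (starM a' b).
Proof.
rewrite [a <o> a']circE -sME (starMDl _ a') (starMDl _ a) starM_vall cjD !sME.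
by rewrite !(@cj_stars (star a a')) //; constructor.
Qed.

Let starM_circr a b b' : starM a (b <o> b') =
  rho a (starM b b') - cj a (starM b b') + starM a b + cj b (starM a b').
Proof.
rewrite [b <o> b']circE -sME (starMDr _ _ b') (starMDr _ _ b) starM_valr cjD !sME.
by rewrite !(@cj_stars (star b b')) //; constructor.
Qed.

Let starM_circA a b c :
  starM (a <o> b) c + starM a b = starM a (b <o> c) + cj a (starM b c).
Proof.
apply: star_val_inj; rewrite !vE.
have := circA a b c; rewrite (circE (a <o> b)) (circE a (b <o> c)).
rewrite (circE a b) (circE b c).
by move/(congr1 (fun t => t <+> <-> (a <+> b <+> c))); rewrite !gs.
Qed.

(* The two bracketings of [a o b o c]. *)
Let starM_cocycle a b c :
  rho a (starM b c) - cj a (starM b c) =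
  starM a c - cj b (starM a c) + (rho c (starM a b) - starM a b).
Proof.
have E := starM_circA a b c; rewrite starM_circl starM_circr in E.
apply: (addIr (starM a b + cj b (starM a c) + cj a (starM b c))).
by rewrite !addrA -E [RHS](AC (7) (3*4*1*7*5*(6*2))) /= subrr GRing.addr0.
Qed.

(* [starM c] is a derivation, evaluated here on the two sides of *)
(* [a + b = (star b a - star a b) + (b + a)]. *)
Let starM_comm a b c :
  starM c a + cj a (starM c b) =
  rho c (starM b a - starM a b) - cj c (starM b a - starM a b) +
  (starM c b + cj b (starM c a)).
Proof.
rewrite -!starMDr -starM_valr; set m := _ - _.
rewrite -[X in _ = _ + X](@cj_stars (star_val m)); last exact: star_valP.
by rewrite -starMDr /m addrC; congr starM; rewrite !vE /star (circC b a) !gs.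
Qed.

(** Substituting two instances of [starM_cocycle] into [starM_comm] cancels every conjugation by [c]
    or [b]; what remains is this symmetry. In the product model it reads r_a (q_c r_b) = r_b (q_c
    r_a). *)
Lemma starM_swapr a b c :
  rho a (starM c b) - starM c b = rho b (starM c a) - starM c a.
Proof.
have := starM_comm a b c; rewrite rhoB cjB.
have := starM_cocycle c b a; have := starM_cocycle c a b.
set p := starM c a; set q := starM c b.
set u := starM a b; set v := starM b a => Eu Ev.
have -> : rho c v - rho c u - (cj c v - cj c u) =
    rho c v - cj c v - (rho c u - cj c u).
  by rewrite !opprB !addrA [LHS](AC 4 (1*4*3*2)).
rewrite Eu Ev => E; apply/eqP; rewrite -subr_eq0; apply/eqP.
apply: (addIr (p + cj a q)); rewrite add0r [RHS]E !opprD !opprK !addrA.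
by rewrite [RHS](AC 10 (3*4*7*8*1*6*(5*9)*(2*10))) /= !addNr !GRing.addr0.
Qed.

(** By [starM_swapr], the term (rho_c - 1) s(a,b) of the cocycle identity equals (rho_b - 1) s(a,c),
    and the two terms in s(a,c) combine. *)
Lemma starM_swapl a b c :
  rho a (starM b c) - cj a (starM b c) = rho b (starM a c) - cj b (starM a c).
Proof.
by rewrite starM_cocycle (starM_swapr c b a) addrC addrA subrK.
Qed.

(** This is the rule obeyed by q_a r_b with q_a = rho_a - c_a. Together with [starM_circDr],
    [starMDl] and [starMDr] it determines s on B from its values on generators. *)
Lemma starM_circDl a a' b :
  starM (a <o> a') b = rho a' (starM a b) + cj a (starM a' b).
Proof. by rewrite starM_circl starM_swapr subrK. Qed.

Lemma starM_circDr a b b' :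
  starM a (b <o> b') = starM a b + rho b (starM a b').
Proof.
by rewrite starM_circr starM_swapl [LHS](AC 4 (3*(1*(4*2)))) /= subrr GRing.addr0.
Qed.

(** * The quotient B/M *)

Definition star_cong : rel {classic B} :=
  fun a b => `[< in_stars (<-> (a : B) <+> (b : B)) >].

Fact star_cong_refl : reflexive star_cong.
Proof. by move=> a; apply/asboolP; rewrite addN; constructor. Qed.
Fact star_cong_sym : symmetric star_cong.
Proof.
have sym (a b : {classic B}) : star_cong a b -> star_cong b a.
  by move=> /asboolP/in_starsN ab; apply/asboolP; rewrite !gs in ab.
by move=> a b; apply/idP/idP; exact: sym.
Qed.
Fact star_cong_trans : transitive star_cong.
Proof.
move=> b a c /asboolP ab /asboolP bc; apply/asboolP.
by have := in_starsD ab bc; rewrite !gs.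
Qed.

Canonical star_cong_equiv :=
  EquivRel star_cong star_cong_refl star_cong_sym star_cong_trans.

Definition star_quotient (_ : commutative_skew_brace B) : Type :=
  {eq_quot star_cong}.
Local Notation Q := (star_quotient hB).

HB.instance Definition _ := Choice.on Q.

Definition star_pi (a : B) : Q := \pi_({eq_quot star_cong}) (a : {classic B}).
Definition star_repr (x : Q) : B := repr (x : {eq_quot star_cong}).

Let star_reprK x : star_pi (star_repr x) = x.
Proof. exact: reprK. Qed.

Lemma star_piP a b : star_pi a = star_pi b <-> in_stars (<-> a <+> b).
Proof.
split; first by move/eqmodP/asboolP.
by move=> ab; apply/eqmodP/asboolP.
Qed.

Let star_pi_cong a a' b b' : star_pi a = star_pi a' -> star_pi b = star_pi b' ->
  star_pi (a <+> b) = star_pi (a' <+> b').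
Proof.
move=> /star_piP aa' /star_piP bb'; apply/star_piP.
have := in_starsD (in_starsJ (<-> b) aa') bb'.
by rewrite !gs.
Qed.

(** This makes the quotient abelian: addition modulo M inherits the commutativity of o. *)
Let star_pi_circ a b : star_pi (a <o> b) = star_pi (a <+> b).
Proof.
apply/star_piP; have := in_starsJ (<-> (a <o> b)) (in_starsN (in_stars_star a b)).
by rewrite [in X in X -> _]/star !gs.
Qed.

Definition star_quot_add (x y : Q) : Q := star_pi (star_repr x <+> star_repr y).
Definition star_quot_opp (x : Q) : Q := star_pi (<-> star_repr x).

Fact star_quot_addA : associative star_quot_add.
Proof.
move=> x y z; rewrite /star_quot_add.
transitivity (star_pi (star_repr x <+> (star_repr y <+> star_repr z))).
  by apply: star_pi_cong; rewrite star_reprK.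
by rewrite -addA; apply: star_pi_cong; rewrite star_reprK.
Qed.
Fact star_quot_addC : commutative star_quot_add.
Proof. by move=> x y; rewrite /star_quot_add -!star_pi_circ circC. Qed.
Fact star_quot_add0 : left_id (star_pi zero) star_quot_add.
Proof.
move=> x; rewrite -[RHS]star_reprK -[in RHS](add0 (star_repr x)).
by apply: star_pi_cong; rewrite ?star_reprK.
Qed.
Fact star_quot_addN : left_inverse (star_pi zero) star_quot_opp star_quot_add.
Proof.
move=> x; rewrite -(addN (star_repr x)).
by apply: star_pi_cong; rewrite ?star_reprK.
Qed.
HB.instance Definition _ := GRing.isZmodule.Build Q
  star_quot_addA star_quot_addC star_quot_add0 star_quot_addN.

Lemma star_piD a b : star_pi (a <+> b) = star_pi a + star_pi b.
Proof. by apply: star_pi_cong; rewrite star_reprK. Qed.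

Lemma star_piM a b : star_pi (a <o> b) = star_pi a + star_pi b.
Proof. by rewrite star_pi_circ star_piD. Qed.

Lemma star_pi_eq0 a : star_pi a = 0 -> in_stars a.
Proof. by move/esym/star_piP; rewrite !gs. Qed.

End BraceCalculus.

(** * Commuting additive operators *)

Section CommutingOperators.
Variables (M : zmodType) (T : Type) (theta : T -> M -> M).
Hypothesis thetaB : forall t, {morph theta t : x y / x - y}.
Hypothesis thetaC : forall t u x, theta t (theta u x) = theta u (theta t x).
Hypothesis M_neq0 : exists x : M, x <> 0.

(** The ring of endomorphisms generated by the [theta t]; zero, negatives and sums are all obtained
    from subtraction. *)
Inductive operator : (M -> M) -> Prop :=
| operator1 : operator id
| operator_gen t : operator (theta t)
| operatorB f g : operator f -> operator g -> operator (fun x => f x - g x)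
| operatorM f g : operator f -> operator g -> operator (f \o g).

Let operator_sub f : operator f -> {morph f : x y / x - y}.
Proof.
elim=> [|t|{}f g _ IHf _ IHg|{}f g _ IHf _ IHg] x y //=.
- exact: thetaB.
- by rewrite IHf IHg !opprB !addrA [LHS](AC 4 (1*4*3*2)).
- by rewrite IHg IHf.
Qed.

Let operator_comm f g : operator f -> operator g -> f \o g =1 g \o f.
Proof.
move=> Of; elim=> [|t|{}g h Og IHg Oh IHh|{}g h _ IHg _ IHh] x //=.
- elim: Of x => [|u|{}f h _ IHf _ IHh|{}f h _ IHf _ IHh] x //=.
  + by rewrite thetaB IHf IHh.
  + by rewrite IHh IHf.
- by rewrite (operator_sub Of) [f (g x)]IHg [f (h x)]IHh.
- by rewrite [f (g _)]IHg /= [f (h _)]IHh.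
Qed.

Definition operator_ring : Type := {f : {classic (M -> M)} | `[< operator f >]}.
Local Notation E := operator_ring.
HB.instance Definition _ := Choice.on E.

Definition mk_op (f : M -> M) (Of : operator f) : E :=
  exist _ (f : {classic (M -> M)}) (introT (asboolP _) Of).
Definition op_val (f : E) : M -> M := sval f.
Let opP (f : E) : operator (op_val f).
Proof. by case: f => f /= /asboolP. Qed.
Let op_eq (f g : E) : op_val f =1 op_val g -> f = g.
Proof. by move=> fg; apply: val_inj; apply: funext. Qed.
Let opB (f : E) : {morph op_val f : x y / x - y}.
Proof. exact: operator_sub (opP f). Qed.
Let op0 f : op_val f 0 = 0.
Proof. by rewrite -[in LHS](subrr 0) opB subrr. Qed.
Let opN f : {morph op_val f : x / - x}.
Proof. by move=> x; rewrite -sub0r opB op0 sub0r. Qed.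
Let opD f : {morph op_val f : x y / x + y}.
Proof. by move=> x y; rewrite -[in LHS](opprK y) opB opN opprK. Qed.

Definition op_one : E := mk_op operator1.
Definition op_sub (f g : E) : E := mk_op (operatorB (opP f) (opP g)).
Definition op_zero : E := op_sub op_one op_one.
Definition op_opp (f : E) : E := op_sub op_zero f.
Definition op_add (f g : E) : E := op_sub f (op_opp g).
Definition op_mul (f g : E) : E := mk_op (operatorM (opP f) (opP g)).

Let op_zeroE x : op_val op_zero x = 0. Proof. by rewrite /= subrr. Qed.
Let op_oppE f x : op_val (op_opp f) x = - op_val f x.
Proof. by rewrite /= subrr sub0r. Qed.
Let op_addE f g x : op_val (op_add f g) x = op_val f x + op_val g x.
Proof. by rewrite /= subrr sub0r opprK. Qed.
Let op_mulE f g x : op_val (op_mul f g) x = op_val f (op_val g x).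
Proof. by []. Qed.
Let opE := (op_zeroE, op_oppE, op_addE, op_mulE).

Fact op_addA : associative op_add.
Proof. by move=> f g h; apply: op_eq => x; rewrite !opE addrA. Qed.
Fact op_addC : commutative op_add.
Proof. by move=> f g; apply: op_eq => x; rewrite !opE addrC. Qed.
Fact op_add0 : left_id op_zero op_add.
Proof. by move=> f; apply: op_eq => x; rewrite !opE add0r. Qed.
Fact op_addN : left_inverse op_zero op_opp op_add.
Proof. by move=> f; apply: op_eq => x; rewrite !opE addNr. Qed.
HB.instance Definition _ :=
  GRing.isZmodule.Build E op_addA op_addC op_add0 op_addN.

Fact op_mulA : associative op_mul.
Proof. by move=> f g h; apply: op_eq => x; rewrite !opE. Qed.
Fact op_mulC : commutative op_mul.
Proof.
by move=> f g; apply: op_eq => x; rewrite !opE; exact: (operator_comm (opP f) (opP g)).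
Qed.
Fact op_mul1 : left_id op_one op_mul.
Proof. by move=> f; apply: op_eq. Qed.
Fact op_mulDl : left_distributive op_mul op_add.
Proof. by move=> f g h; apply: op_eq => x; rewrite !opE. Qed.
Fact op_one_neq0 : op_one != op_zero.
Proof.
have [x x0] := M_neq0; apply/eqP => /(congr1 (op_val^~ x)).
by rewrite op_zeroE.
Qed.

HB.instance Definition _ := GRing.Zmodule_isComNzRing.Build E
  op_mulA op_mulC op_mul1 op_mulDl op_one_neq0.

Definition operator_module : Type := M.
HB.instance Definition _ := GRing.Zmodule.on operator_module.

Fact op_scaleA (f g : E) (v : operator_module) :
  op_val f (op_val g v) = op_val (f * g) v.
Proof. by []. Qed.
Fact op_scale1 : left_id (1 : E) (op_val : E -> operator_module -> operator_module).
Proof. by []. Qed.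
Fact op_scaleDr : right_distributive
  (op_val : E -> operator_module -> operator_module) +%R.
Proof. exact: opD. Qed.
Fact op_scaleDl (v : operator_module) :
  {morph (op_val : E -> operator_module -> operator_module)^~ v : f g / f + g}.
Proof. by move=> f g; exact: op_addE. Qed.
HB.instance Definition _ := GRing.Zmodule_isLmodule.Build E operator_module
  op_scaleA op_scale1 op_scaleDr op_scaleDl.

(** Faithfulness is extensionality, since the scalars are functions on M. The existential form keeps
    the ring and the module abstract afterwards. *)
Lemma commuting_operators :
  exists (C : comNzRingType) (V : lmodType C) (j : M -> V) (g : T -> C),
  [/\ bijective j, {morph j : x y / x - y},
      forall t x, j (theta t x) = g t *: j x
    & forall a b : C, (forall v : V, a *: v = b *: v) -> a = b].
Proof.
exists (E : comNzRingType), (operator_module : lmodType E), id.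
exists (fun t => mk_op (operator_gen t)); split=> //; first by exists id.
Qed.

End CommutingOperators.

(** * Subgroups of free abelian groups *)

Section FreeAbelianSubgroups.
Variables (S : choiceType) (T : Type) (op : T -> T -> T) (e : T) (inv : T -> T).
Hypothesis opG : is_group op e inv.
Variable h : T -> {freeg S / int}.
Hypotheses (h_inj : injective h) (hM : {morph h : x y / op x y >-> x + y}).

Let h1 : h e = 0.
Proof.
have := hM e e; rewrite (group_left_id opG) => /eqP.
by rewrite eq_sym -subr_eq0 addrK => /eqP.
Qed.
Let hV x : h (inv x) = - h x.
Proof.
by apply/eqP; rewrite -subr_eq0 opprK -hM (group_left_inv opG) h1.
Qed.

Let image_zmod : forall x y, exists z, h z = h x - h y.
Proof. by move=> x y; exists (op x (inv y)); rewrite hM hV. Qed.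

Let image_mulz x (n : int) : exists z, h z = h x *~ n.
Proof.
have P (k : nat) : exists z, h z = h x *+ k.
  elim: k => [|k [z Ez]]; first by exists e; rewrite h1.
  by exists (op x z); rewrite hM Ez mulrS.
case: n => k; first exact: P.
by have [z Ez] := P k.+1; exists (inv z); rewrite hV Ez NegzE mulrNz.
Qed.

Let le : rel S := sval (well_ordering_principle S).
Let le_wo : well_order le := svalP (well_ordering_principle S).

Let le_chain : wo_chain le predT.
Proof. by move=> A _; exact: le_wo. Qed.
Let le_total : total le.
Proof. by move=> x y; exact: (wo_chainW le_chain). Qed.
Let le_refl : reflexive le.
Proof. by move=> x; exact: (wo_chain_reflexive le_chain). Qed.
Let le_anti : antisymmetric le.
Proof. by move=> x y; exact: (wo_chain_antisymmetric le_chain). Qed.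

(** The well-order is given by least elements of nonempty sets, so transitivity is read off from the
    least element of {x, y, z}. *)
Let le_trans : transitive le.
Proof.
move=> y x z xy yz; pose A : {pred S} := [pred t | t \in [:: x; y; z]].
have [|m [[mA mmin] _]] := @le_wo A; first by exists x; rewrite !inE eqxx.
have Am t : t \in [:: x; y; z] -> le m t by move=> tA; apply: mmin.
have [mx my mz] : [/\ le m x, le m y & le m z].
  by split; apply: Am; rewrite !inE eqxx ?orbT.
move: mA; rewrite !inE => /or3P[] /eqP E; rewrite -{}E in xy yz *.
- by [].
- by rewrite (@le_anti x m) ?xy.
- by rewrite -(@le_anti y m) ?yz.
Qed.

Let seq_max (l : seq S) : l != [::] -> exists2 m, m \in l & {in l, forall x, le x m}.
Proof.
elim: l => // x [_ _|y l /(_ isT)[m ml mmax] _].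
  by exists x; rewrite ?inE // => t /[!inE] /eqP->.
have [xm|mx] := orP (le_total x m).
  by exists m; [rewrite in_cons ml orbT|move=> t; rewrite in_cons => /predU1P[->|/mmax]].
exists x; [exact: mem_head|move=> t; rewrite in_cons => /predU1P[->|/mmax tm] //].
exact: le_trans tm mx.
Qed.

Let le_ind (P : S -> Prop) :
  (forall x, (forall y, le y x -> y != x -> P y) -> P x) -> forall x, P x.
Proof.
move=> IH x; apply: contrapT => nPx.
have [|z [[zA zmin] _]] := @le_wo [pred y | `[< ~ P y >]].
  by exists x; rewrite inE; apply/asboolP.
move: zA; rewrite inE => /asboolP; apply; apply: IH => y yz ny.
apply: contrapT => nPy; case/eqP: ny; apply: le_anti; rewrite yz /=.
by apply: zmin; rewrite inE; apply/asboolP.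
Qed.

Let below (D : {freeg S / int}) s := forall s', coeff s' D != 0 -> le s' s.

Let lead_ideal s (n : int) := exists x, below (h x) s /\ coeff s (h x) = n.

Let belowD D D' s : below D s -> below D' s -> below (D + D') s.
Proof.
move=> Ds D's s'; rewrite coeffD; apply: contraNT => ns.
by rewrite (contraNeq (Ds s') ns) ?(contraNeq (D's s') ns) //.
Qed.
Let belowN D s : below D s -> below (- D) s.
Proof. by move=> Ds s'; rewrite coeffN oppr_eq0; apply: Ds. Qed.
Let belowMz D s n : below D s -> below (D *~ n) s.
Proof.
move=> Ds s' ns; apply: Ds; apply: contraNneq ns => D0.
by rewrite raddfMz /= D0 mul0rz.
Qed.

(** The coefficients at [s] of image elements supported up to [s] form an ideal of the integers, and
    its least positive member divides the others by division with remainder. If there is none, [e],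
    whose image is 0, serves as generator. *)
Let lead_generator s : exists x, below (h x) s /\
  forall y, below (h y) s -> exists n, coeff s (h y) = n * coeff s (h x).
Proof.
have [[n [n0 [x [xs xn]]]]|] := pselect (exists n : nat, (0 < n)%N /\ lead_ideal s n%:Z);
  last first.
  move=> none; exists e; split=> [s'|y ys]; first by rewrite h1 coeff0 eqxx.
  exists 0; rewrite mul0r; apply: contrapT => /eqP y0; apply: none.
  exists `|coeff s (h y)|%N; rewrite absz_gt0 y0; split=> //.
  have [y_ge0|y_lt0] := ger0P (coeff s (h y)).
    by exists y; rewrite gez0_abs.
  by exists (inv y); rewrite hV coeffN; split; [exact: belowN|rewrite ltz0_abs].
have Pn : exists n : nat, (0 < n)%N && `[< lead_ideal s n%:Z >].
  by exists n; rewrite n0; apply/asboolP; exists x.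
case: (ex_minnP Pn) => k /andP[k0 /asboolP[z [zs zk]]] kmin.
exists z; split=> // y ys; rewrite zk.
exists (coeff s (h y) %/ k)%Z; apply/eqP.
rewrite {1}(divz_eq (coeff s (h y)) k) -subr_eq0 addrC addKr; apply/eqP.
have r_ge0 : 0 <= (coeff s (h y) %% k)%Z by rewrite modz_ge0 // -lt0n.
apply: contrapT => /eqP r0.
have [v Ev] := image_mulz z (coeff s (h y) %/ k)%Z.
have [u Eu] := image_zmod y v.
have /kmin : (0 < `|(coeff s (h y) %% k)%Z|)%N &&
    `[< lead_ideal s `|(coeff s (h y) %% k)%Z|%N%:Z >].
  rewrite absz_gt0 r0; apply/asboolP; exists u; split.
    by rewrite Eu Ev; apply: belowD => //; apply/belowN/belowMz.
  rewrite gez0_abs // Eu Ev coeffB raddfMz /= zk.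
  by rewrite {1}(divz_eq (coeff s (h y)) k) mulrzz (mulrC k%:Z) addrAC subrr add0r.
rewrite leqNgt => /negP; apply; rewrite -ltz_nat gez0_abs //.
by apply: ltz_pmod; rewrite ltz_nat.
Qed.

Let gen s : T := sval (cid (lead_generator s)).
Let gen_below s : below (h (gen s)) s.
Proof. by have [] := svalP (cid (lead_generator s)). Qed.
Let gen_lead s y : below (h y) s ->
  exists n, coeff s (h y) = n * coeff s (h (gen s)).
Proof. by have [_] := svalP (cid (lead_generator s)); apply. Qed.

(** The indices whose ideal of leading coefficients is nonzero; these alone contribute a basis
    element. *)
Definition lead_index : Type := {s : S | coeff s (h (gen s)) != 0}.
HB.instance Definition _ := Choice.on lead_index.
Local Notation J := lead_index.

Let comb : {freeg J / int} -> {freeg S / int} :=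
  fglift (fun j : J => h (gen (val j))).

Let combD : {morph comb : D D' / D + D'}.
Proof.
move=> D D'; have combB := lift_is_additive (fun j : J => h (gen (val j))).
have comb0 : comb 0 = 0 by rewrite -[in LHS](subrr 0) /comb combB subrr.
have combN E : comb (- E) = - comb E.
  by rewrite -sub0r /comb combB -/comb comb0 sub0r.
by rewrite -[in LHS](opprK D') /comb combB -/comb combN opprK.
Qed.
Let comb0 : comb 0 = 0.
Proof. by apply: (addIr (comb 0)); rewrite -combD !add0r. Qed.
Let combN D : comb (- D) = - comb D.
Proof. by apply: (addIr (comb D)); rewrite -combD !addNr. Qed.

Let combU n (j : J) : comb [freeg [:: (n, j)]] = h (gen (val j)) *~ n.
Proof. by rewrite /comb liftU -[n in LHS]intz scaler_int. Qed.

Let comb_image D : exists x, h x = comb D.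
Proof.
elim/freeg_ind_dom0: D => [|n j D _ _ [x Ex]]; first by exists e; rewrite h1 comb0.
have [y Ey] := image_mulz (gen (val j)) n.
by exists (op y x); rewrite hM Ex Ey combD combU.
Qed.

Let coeff_comb s D :
  coeff s (comb D) = \sum_(j <- dom D) coeff j D * coeff s (h (gen (val j))).
Proof.
have combS (r : seq J) (F : J -> {freeg J / int}) :
    comb (\sum_(j <- r) F j) = \sum_(j <- r) comb (F j).
  exact: (big_morph comb combD comb0).
rewrite -{1}(freeg_sumE D) combS raddf_sum; apply: eq_bigr => j _ /=.
by rewrite combU raddfMz /= -mulrzl intz.
Qed.

(** The generators are triangular: at the largest index occurring in [D], only the generator of that
    index has a nonzero coefficient. *)
Let comb_inj D : comb D = 0 -> D = 0.
Proof.
move=> D0; apply/eqP; rewrite -dom_eq0; apply: contraT => domD.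
have [|_ /mapP[j jD ->] jmax] := @seq_max [seq val j | j <- dom D].
  by case: (dom D) domD.
have := congr1 (coeff (val j)) D0.
rewrite coeff0 coeff_comb (bigD1_seq j) ?uniq_dom //= big1_seq ?addr0.
  move/eqP; rewrite mulf_eq0 (negPf (valP j)) orbF.
  by rewrite mem_dom in jD; rewrite (negPf jD).
move=> j' /andP[j'j j'D]; apply/eqP; rewrite mulf_eq0; apply/orP; right.
apply: contraTT j'j => /gen_below jj'; rewrite negbK.
by apply/eqP/val_inj/le_anti; rewrite jj' jmax //; apply: map_f.
Qed.

Let below_max D : D != 0 -> exists2 s, coeff s D != 0 & below D s.
Proof.
rewrite -dom_eq0 => /seq_max[s sD smax]; exists s; first by rewrite -mem_dom.
by move=> s' s'D; apply: smax; rewrite mem_dom.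
Qed.

(** Well-founded induction on the bound: subtracting a multiple of [gen s] kills the coefficient at
    [s], so what remains is bounded by a smaller index. *)
Let comb_surj s x : below (h x) s -> exists D, comb D = h x.
Proof.
elim/le_ind: s x => s IH.
have IH0 x : below (h x) s -> coeff s (h x) = 0 -> exists D, comb D = h x.
  move=> xs x0; have [->|/below_max[s' s'x xs']] := eqVneq (h x) 0.
    by exists 0; rewrite comb0.
  by apply: (IH s' _ _ x xs'); [exact: xs|apply: contraNneq s'x => ->; rewrite x0].
move=> x xs; have [/(IH0 x xs)//|x0] := eqVneq (coeff s (h x)) 0.
have [n En] := gen_lead xs.
have g0 : coeff s (h (gen s)) != 0.
  by apply: contraNneq x0 => g0; rewrite En g0 mulr0.
have [v Ev] := image_mulz (gen s) n.
have [u Eu] := image_zmod x v.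
have [||D ED] := IH0 u.
- by rewrite Eu Ev; apply/belowD => //; apply/belowN/belowMz/gen_below.
- by rewrite Eu Ev coeffB raddfMz /= En -mulrzl intz subrr.
exists (D + [freeg [:: (n, exist _ s g0 : J)]]).
by rewrite combD combU ED Eu Ev subrK.
Qed.

Lemma subgroup_free_abelian : free_abelian op.
Proof.
pose f D : T := sval (cid (comb_image D)).
have hf D : h (f D) = comb D by exact: svalP (cid (comb_image D)).
have fD : {morph f : u v / GRing.add u v >-> op u v}.
  by move=> u v; apply: h_inj; rewrite hM !hf combD.
have f_surj x : exists D, f D = x.
  have [x0|/below_max[s _ xs]] := eqVneq (h x) 0.
    by exists 0; apply: h_inj; rewrite hf comb0.
  by have [D ED] := comb_surj xs; exists D; apply: h_inj; rewrite hf.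
exists (J : choiceType), f; split=> //.
exists (fun x => sval (cid (f_surj x))) => [D|x].
  apply/eqP; rewrite -subr_eq0; apply/eqP/comb_inj.
  rewrite combD combN -!hf (svalP (cid (f_surj (f D)))).
  by rewrite subrr.
exact: svalP (cid (f_surj x)).
Qed.

End FreeAbelianSubgroups.

(** * Integer polynomials in arbitrarily many variables *)

Notation zpoly I := {malg int[{cmonom I}]}.

Section Evaluation.
Variables (I : choiceType) (R : comNzRingType) (g : I -> R).
Implicit Types m : {cmonom I}.

Definition mon_eval m : R := \prod_(i <- finsupp m) g i ^+ m i.

Lemma mon_evalEw m (d : {fset I}) : fsubset (finsupp m) d ->
  mon_eval m = \prod_(i <- d) g i ^+ m i.
Proof.
move=> le; rewrite [LHS](big_fset_incl _ le) // => i id.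
by rewrite -cmE_neq0 negbK => /eqP ->.
Qed.

Fact mon_eval_mmorphism : mmorphism mon_eval.
Proof.
split=> [m1 m2|]; last by rewrite /mon_eval mdom1 big_seq_fset0.
rewrite /mon_eval mdomD -/(mon_eval m1) -/(mon_eval m2).
rewrite (mon_evalEw (fsubsetUl _ (finsupp m2))).
rewrite (mon_evalEw (fsubsetUr (finsupp m1) _)) -big_split /=.
by apply: eq_bigr => i _; rewrite cmM exprD.
Qed.
HB.instance Definition _ := isMultiplicative.Build _ _ mon_eval mon_eval_mmorphism.

Lemma mon_evalU i : mon_eval (ucm i) = g i.
Proof. by rewrite /mon_eval mdomU big_seq_fset1 cmUU expr1. Qed.

Definition zeval : zpoly I -> R := mmap (intr : int -> R) mon_eval.
HB.instance Definition _ := GRing.RMorphism.on zeval.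

Lemma zevalU k m : zeval (mkmalgU m k) = k%:~R * mon_eval m.
Proof. exact: mmapU. Qed.
End Evaluation.

(* Locked, lest unification unfold monomials when comparing two variables. *)
Fact zvar_key : unit. Proof. exact: tt. Qed.
Definition zvar (I : choiceType) (i : I) : zpoly I :=
  locked_with zvar_key (mkmalgU (ucm i) 1).

Lemma zvarE (I : choiceType) (i : I) : zvar i = mkmalgU (ucm i) 1.
Proof. by rewrite /zvar locked_withE. Qed.

Lemma zeval_var (I : choiceType) (R : comNzRingType) (g : I -> R) i :
  zeval g (zvar i) = g i.
Proof. by rewrite zvarE zevalU mon_evalU mul1r. Qed.

(** * Integer polynomials have no zero divisors *)

Section IntegralDomain.
Variable I : choiceType.
Implicit Types (m : {cmonom I}) (w : I -> nat) (p q : zpoly I).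

Definition weight w m : nat := (\sum_(i <- finsupp m) m i * w i)%N.

Let weight_shift w i L m :
  weight (fun j => L * w j + (j == i))%N m = (L * weight w m + m i)%N.
Proof.
rewrite /weight big_distrr /= -[in RHS](addn0 (m i)).
under eq_bigr do rewrite mulnDr mulnCA.
rewrite big_split /= addn0; congr (_ + _)%N.
have [im|im] := boolP (i \in finsupp m).
  rewrite (big_fsetD1 i) //= eqxx muln1 big1_fset ?addn0 // => j.
  by rewrite in_fsetD1 => /andP[/negPf-> _]; rewrite muln0.
have /eqP-> : m i == 0%N by rewrite cmE_eq0.
rewrite big1_fset // => j jm _; case: eqP => [ji|]; last by rewrite muln0.
by rewrite -ji jm in im.
Qed.

Let weight_sep (s : seq ({cmonom I} * {cmonom I})) :
  all (fun mm => mm.1 != mm.2) s ->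
  exists w, all (fun mm => weight w mm.1 != weight w mm.2) s.
Proof.
elim: s => [|[m m'] s IHs] /=; first by exists (fun _ => 0%N).
move=> /andP[mm' /IHs[w sw]].
have [ww'|] := eqVneq (weight w m) (weight w m'); last first.
  by move=> ww'; exists w; rewrite ww'.
have /existsNP[i /eqP mi] : ~ forall i, m i = m' i by move=> /cmP; apply/negP.
(* As [L] exceeds every exponent of [i] in the pairs already separated, the old weight of such a
   monomial is the quotient of the new one by [L], so those pairs stay separated. The new pair had
   equal weights and is told apart by its exponents of [i]. *)
pose L := (\max_(x <- s) maxn (x.1 i) (x.2 i)).+1.
exists (fun j => L * w j + (j == i))%N; rewrite !weight_shift ww' eqn_add2l mi /=.
apply/allP => -[a b] abs; rewrite /= !weight_shift.
have := allP sw _ abs; rewrite /= => wab.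
have : (maxn (a i) (b i) < L)%N by rewrite ltnS (leq_bigmax_seq (a, b)).
rewrite gtn_max => /andP[aL bL]; apply: contraNneq wab => E.
have /(congr1 (divn^~ L)) := E.
by rewrite !(mulnC L) !divnMDl // !divn_small // !addn0 => ->.
Qed.

Let mon_evalX w m : mon_eval (fun i => 'X^(w i) : {poly int}) m = 'X^(weight w m).
Proof.
rewrite /mon_eval /weight; elim: (finsupp m : seq I) => [|i s IHs].
  by rewrite !big_nil.
by rewrite !big_cons IHs -exprM mulnC exprD.
Qed.

Let zeval_neq0 w p : {in msupp p &, injective (weight w)} -> p != 0 ->
  zeval (fun i => 'X^(w i) : {poly int}) p != 0.
Proof.
move=> inj_w; rewrite -msupp_eq0 => /fset0Pn[m mp].
apply/eqP => /(congr1 (fun q : {poly int} => q`_(weight w m))).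
rewrite /zeval mmapE coef_sum coef0 (big_fsetD1 m) //= big1_fset.
  rewrite mon_evalX mulrzl coefMrz coefXn eqxx addr0 intz.
  by move=> /eqP; rewrite mcoeff_eq0 mp.
move=> m'; rewrite in_fsetD1 => /andP[m'm m'p] _.
rewrite mon_evalX mulrzl coefMrz coefXn.
by rewrite (inj_in_eq inj_w) // eq_sym (negPf m'm) mul0rz.
Qed.

(** Replacing the variable i by X^(w i) reduces the claim to Z[X]. The weights separate the finitely
    many monomials of [p] and [q], so no terms merge and neither factor becomes zero. *)
Fact zpoly_idomain (p q : zpoly I) : p * q = 0 -> (p == 0) || (q == 0).
Proof.
move=> pq0; apply/negPn; rewrite negb_or; apply/negP => /andP[p0 q0].
pose d := msupp p ++ msupp q.
pose s := [seq mm <- [seq (m, m') | m <- d, m' <- d] | mm.1 != mm.2].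
have [|w /allP sw] := @weight_sep s; first exact: filter_all.
have inj_w : {in d &, injective (weight w)}.
  move=> m m' md m'd; apply: contra_eq => mm'.
  by apply: (sw (m, m')); rewrite mem_filter mm' /=; apply/allpairsP; exists (m, m').
have := congr1 (zeval (fun i => 'X^(w i) : {poly int})) pq0.
rewrite rmorph0 rmorphM => /eqP; rewrite mulf_eq0 => /orP[]; apply/negP.
  by apply: zeval_neq0 => // m m' mp m'p; apply: inj_w; rewrite mem_cat ?mp ?m'p.
by apply: zeval_neq0 => // m m' mp m'p; apply: inj_w; rewrite mem_cat ?mp ?m'p orbT.
Qed.

End IntegralDomain.

(** * Fraction fields of domains, with inverses chosen classically *)

Section ClassicalFractions.
Variable R : comNzRingType.
Hypothesis R_domain : forall x y : R, x * y = 0 -> (x == 0) || (y == 0).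

Definition domain_ring : Type := R.
HB.instance Definition _ := GRing.ComNzRing.on domain_ring.
Local Notation D := domain_ring.

Definition domain_unit : pred D := fun x => `[< exists y : D, y * x == 1 >].
Definition domain_inv (x : D) : D :=
  if pselect (exists y : D, y * x == 1) is left h then xchoose h else x.

Fact domain_mulVx : {in domain_unit, left_inverse 1 domain_inv *%R}.
Proof.
move=> x /asboolP ux; rewrite /domain_inv; case: pselect => // h.
exact/eqP/(xchooseP h).
Qed.
Fact domain_unitPl (x y : D) : y * x = 1 -> domain_unit x.
Proof. by move=> yx; apply/asboolP; exists y; rewrite yx. Qed.
Fact domain_inv_out : {in [predC domain_unit], domain_inv =1 id}.
Proof.
move=> x nux; rewrite /domain_inv; case: pselect => // h.
by case/negP: nux; apply/asboolP.
Qed.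
HB.instance Definition _ := GRing.ComNzRing_hasMulInverse.Build D
  domain_mulVx domain_unitPl domain_inv_out.
HB.instance Definition _ := GRing.ComUnitRing_isIntegral.Build D R_domain.

Lemma fraction_field_exists :
  exists (F : fieldType) (f : {rmorphism R -> F}), injective f.
Proof.
exists {fraction D}, (@tofrac D : {rmorphism D -> {fraction D}}).
by move=> x y /eqP; rewrite tofrac_eq => /eqP.
Qed.
End ClassicalFractions.

(** * Unique factorization in F[t] *)

Section UniqueFactorization.
Variable F : fieldType.
Implicit Types (p q : {poly F}) (s : seq {poly F}).

Definition prime_poly p := `[< p \is monic /\ irreducible_poly p >].

Lemma prime_factorization p : p != 0 ->
  exists s, all prime_poly s /\ p = lead_coef p *: \prod_(q <- s) q.
Proof.
have [n] := ubnP (size p); elim: n p => // n IH p; rewrite ltnS => pn p0.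
have [p1|p1] := leqP (size p) 1.
  exists [::]; split=> //; rewrite big_nil {1}(size1_polyC p1) lead_coefE.
  rewrite (_ : (size p).-1 = 0)%N ?alg_polyC //; by case: (size p) p1 => [|[]].
have [irr_p|nirr] := pselect (irreducible_poly p).
  have lp : lead_coef p != 0 by rewrite lead_coef_eq0.
  exists [:: (lead_coef p)^-1 *: p]; split; last first.
    by rewrite big_seq1 scalerA mulfV // scale1r.
  rewrite /= andbT; apply/asboolP; split.
    by rewrite monicE lead_coefZ mulVf.
  split=> [|q q1]; first by rewrite size_scale ?invr_eq0.
  rewrite dvdpZr ?invr_eq0 // => /(irr_p.2 q q1) qp.
  by rewrite (eqp_trans qp) // eqp_sym eqp_scale // invr_eq0.
have [q [q1 qp nqp]] : exists q, [/\ size q != 1%N, q %| p & ~~ (q %= p)].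
  apply: contrapT => none; apply: nirr; split=> // q q1 qp.
  by apply: contrapT => /negP nqp; apply: none; exists q.
have Ep := divpK qp; have := p0; rewrite -Ep mulf_eq0 negb_or => /andP[r0 q0].
have szp : size p = (size (p %/ q)%R + size q).-1 by rewrite -[in LHS]Ep size_mul.
have q2 : (1 < size q)%N.
  by rewrite ltn_neqAle eq_sym q1 size_poly_gt0.
have r2 : (1 < size (p %/ q)%R)%N.
  rewrite ltn_neqAle size_poly_gt0 r0 andbT eq_sym.
  apply: contraNneq nqp => r1; rewrite -dvdp_size_eqp //.
  by rewrite szp r1 add1n.
have [||s [s_pr Es]] := IH (p %/ q); rewrite ?r0 //.
  apply: leq_trans pn; rewrite szp; case: (size q) q2 => [|[|k]] // _.
  by rewrite !addnS ltnS leq_addr.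
have [||t [t_pr Et]] := IH q; rewrite ?q0 //.
  apply: leq_trans pn; rewrite szp; case: (size _) r2 => [|[|k]] // _.
  by rewrite !addSn ltnS leq_addl.
exists (s ++ t); rewrite all_cat s_pr t_pr big_cat /=; split=> //.
by rewrite lead_coefM -scalerA scalerAr -Et scalerAl -Es.
Qed.

Lemma prime_poly_dvd_prod q s :
  prime_poly q -> all prime_poly s -> q %| \prod_(p <- s) p -> q \in s.
Proof.
move=> /asboolP[q_mon q_irr]; elim: s => [|p s IHs] /=.
  by rewrite big_nil dvdp1 => _ /eqP q1; have := q_irr.1; rewrite q1.
case/andP=> /asboolP[p_mon p_irr] s_pr; rewrite big_cons in_cons.
have [qp|nqp] := boolP (q %| p).
  move=> _; rewrite -eqp_monic //; apply/orP; left.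
  by apply: p_irr.2 => //; have := q_irr.1; case: (size q) => [|[]].
by rewrite Gauss_dvdpr ?irreducible_poly_coprime // => /(IHs s_pr) ->; rewrite orbT.
Qed.

Lemma prime_factorization_uniq s t : all prime_poly s -> all prime_poly t ->
  \prod_(p <- s) p = \prod_(p <- t) p -> perm_eq s t.
Proof.
elim: s t => [|p s IHs] t /=.
  case: t => // q t _ /= /andP[/asboolP[_ q_irr] _]; rewrite big_nil big_cons => E.
  have : size q == 1%N by rewrite -dvdp1 E dvdp_mulr.
  by move/eqP=> q1; have := q_irr.1; rewrite q1.
move=> /andP[p_pr s_pr] t_pr E.
have pt : p \in t by apply: prime_poly_dvd_prod => //; rewrite -E big_cons dvdp_mulr.
rewrite perm_sym (permPl (perm_to_rem pt)) perm_cons perm_sym; apply: IHs => //.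
  by apply/allP => q /mem_rem; exact: (allP t_pr).
have p0 : p != 0 by move/asboolP: p_pr => [/monic_neq0].
apply: (mulfI p0); move: E; rewrite big_cons => ->.
by rewrite (perm_big _ (perm_to_rem pt)) big_cons.
Qed.

Definition factors p : seq {poly F} :=
  if pselect (p != 0) is left p0 then sval (cid (prime_factorization p0)) else [::].

Lemma factorsP p : p != 0 ->
  all prime_poly (factors p) /\ p = lead_coef p *: \prod_(q <- factors p) q.
Proof.
by move=> p0; rewrite /factors; case: pselect => // h; exact: (svalP (cid (prime_factorization h))).
Qed.

Lemma factorsM p q : p != 0 -> q != 0 ->
  perm_eq (factors (p * q)) (factors p ++ factors q).
Proof.
move=> p0 q0; have pq0 : p * q != 0 by rewrite mulf_neq0.
have [p_pr Ep] := factorsP p0; have [q_pr Eq] := factorsP q0.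
have [pq_pr Epq] := factorsP pq0.
apply: prime_factorization_uniq; rewrite ?all_cat ?p_pr ?q_pr // big_cat /=.
apply: (scalerI (a := lead_coef (p * q))); first by rewrite lead_coef_eq0.
by rewrite -Epq [in RHS]lead_coefM -scalerA scalerAr -Eq scalerAl -Ep.
Qed.

Definition divisor p : {freeg {poly F} / int} :=
  \sum_(q <- factors p) [freeg [:: (1, q)]].

Lemma divisorM p q : p != 0 -> q != 0 -> divisor (p * q) = divisor p + divisor q.
Proof.
by move=> p0 q0; rewrite /divisor (perm_big _ (factorsM p0 q0)) big_cat.
Qed.

Let coeff_divisor p q : coeff q (divisor p) = (count_mem q (factors p))%:Z.
Proof.
rewrite /divisor raddf_sum /=; elim: (factors p) => [|r s IHs] /=.
  by rewrite big_nil.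
by rewrite big_cons IHs coeffU mul1r PoszD natz.
Qed.

(** The coefficients of a divisor are multiplicities of prime factors, so equal divisors leave only
    the leading coefficients to differ. *)
Lemma divisor_inj p q : p != 0 -> q != 0 -> divisor p = divisor q ->
  p = (lead_coef p / lead_coef q) *: q.
Proof.
move=> p0 q0 Epq; have [p_pr Ep] := factorsP p0; have [q_pr Eq] := factorsP q0.
have pq : perm_eq (factors p) (factors q).
  apply/allP => r _ /=; apply/eqP.
  have := congr1 (coeff r) Epq; rewrite !coeff_divisor => -[E].
  exact: E.
rewrite (perm_big _ pq) /= in Ep.
by rewrite {1}Ep [X in _ = _ *: X]Eq scalerA divfK // lead_coef_eq0.
Qed.

End UniqueFactorization.

(** * Rational functions with value 1 at 0 *)

Fact affine_frac (K : fieldType) (a b c d n m : K) : b != 0 -> d != 0 -> m != 0 ->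
  a / b + c / d * (n / m - 1) = (a * d * m + c * (n - m) * b) / (b * d * m).
Proof. by move=> b0 d0 m0; field; rewrite b0 d0 m0. Qed.

Section NormalizedFractions.
Variable F : fieldType.
Local Notation L := {fraction {poly F}}.
Local Notation "n %:F" := (tofrac n).
Implicit Types (x y z : L) (n d : {poly F}).

Definition unit_at0 x := exists n d,
  [/\ n.[0] = 1, d.[0] = 1 & x = n%:F / d%:F].

Let horner0_neq0 n : n.[0] = 1 -> n != 0.
Proof. by apply: contra_eqN => /eqP->; rewrite horner0 eq_sym oner_eq0. Qed.

Let frac_neq0 n : n.[0] = 1 -> n%:F != 0 :> L.
Proof. by move/horner0_neq0; rewrite tofrac_eq0. Qed.

Lemma unit_at0_frac n : n.[0] = 1 -> unit_at0 n%:F.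
Proof. by exists n, 1; rewrite hornerC tofrac1 divr1. Qed.

Lemma unit_at0_neq0 x : unit_at0 x -> x != 0.
Proof.
by move=> [n [d [n1 d1 ->]]]; rewrite mulf_neq0 ?invr_eq0 ?frac_neq0.
Qed.

Lemma unit_at0M x y : unit_at0 x -> unit_at0 y -> unit_at0 (x * y).
Proof.
move=> [n [d [n1 d1 ->]]] [m [e [m1 e1 ->]]]; exists (n * m), (d * e).
by rewrite !hornerM n1 m1 d1 e1 !mulr1 !tofracM mulf_div.
Qed.

Lemma unit_at0V x : unit_at0 x -> unit_at0 x^-1.
Proof. by move=> [n [d [n1 d1 ->]]]; exists d, n; rewrite invf_div. Qed.

(** This closure is what the first coordinate of a sum in the affine brace requires. *)
Lemma unit_at0_affine x y z : unit_at0 x -> unit_at0 y -> unit_at0 z ->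
  unit_at0 (x + y * (z - 1)).
Proof.
move=> [a [b [a1 b1 ->]]] [c [d [c1 d1 ->]]] [n [m [n1 m1 ->]]].
exists (a * d * m + c * (n - m) * b), (b * d * m).
rewrite !(hornerE, hornerM) a1 b1 c1 d1 n1 m1 subrr mulr0 mul0r addr0 !mulr1.
split=> //; rewrite !(tofracM, tofracB, tofracD).
by rewrite affine_frac ?frac_neq0.
Qed.

(** The map sends n/d to the difference of the divisors, and is 0 by default elsewhere. If the
    divisors agree then n is a constant multiple of d, and evaluation at 0 shows that the constant
    is 1. *)
Lemma unit_at0_free : exists v : L -> {freeg {poly F} / int},
  (forall x y, unit_at0 x -> unit_at0 y -> v (x * y) = v x + v y) /\
  (forall x, unit_at0 x -> v x = 0 -> x = 1).
Proof.
pose R x (nd : {poly F} * {poly F}) :=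
  [/\ nd.1.[0] = 1, nd.2.[0] = 1 & x = nd.1%:F / nd.2%:F].
pose v x := if pselect (exists nd, R x nd) is left h
  then divisor (sval (cid h)).1 - divisor (sval (cid h)).2 else 0.
have vE n d : n.[0] = 1 -> d.[0] = 1 -> v (n%:F / d%:F) = divisor n - divisor d.
  move=> n1 d1; rewrite /v; case: pselect => [h|]; last by case; exists (n, d).
  case: (cid h) => -[n' d'] [/= n'1 d'1 E].
  have {}E : n * d' = n' * d.
    by apply/eqP; rewrite -(tofrac_eq) !tofracM -eqr_div ?frac_neq0 // E.
  have : divisor n + divisor d' = divisor n' + divisor d.
    by rewrite -!divisorM ?horner0_neq0 // E.
  move=> E'; apply/eqP; rewrite subr_eq addrAC eq_sym subr_eq. by rewrite E'.
exists v; split=> [x y [n [d [n1 d1 ->]]] [m [e [m1 e1 ->]]]|x [n [d [n1 d1 ->]]]].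
  rewrite mulf_div -!tofracM !vE ?hornerM ?n1 ?m1 ?d1 ?e1 ?mulr1 //.
  by rewrite !divisorM ?horner0_neq0 // opprD [LHS](AC (2*2) (1*3*2*4)) /= -addrA.
rewrite vE // => /eqP; rewrite subr_eq0 => /eqP /divisor_inj.
move=> /(_ (horner0_neq0 n1) (horner0_neq0 d1)) E.
have lc : lead_coef n / lead_coef d = 1 by move: n1; rewrite {1}E hornerZ d1 mulr1.
by rewrite E lc scale1r mulfV // frac_neq0.
Qed.

End NormalizedFractions.

(** * Monomials and additive maps on polynomial rings *)

Section Monomials.
Variable I : choiceType.
Implicit Types (i j : I) (k l m : {cmonom I}).

Lemma cmonom_mulIm k l m : mmul k m = mmul l m -> k = l.
Proof.
move=> E; apply/eqP/cmP => i; apply/eqP; rewrite -(eqn_add2r (m i)) -!cmM.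
by rewrite E.
Qed.

Lemma cmonom_divU m i : m i != 0%N -> exists k, m = mmul k (ucm i).
Proof.
move=> mi; exists (divcm m (ucm i)); apply/eqP/cmP => j.
rewrite cmM divcmE cmU subnK //; case: eqP => [<-|//]; by rewrite lt0n.
Qed.

Lemma cmonom_ind (P : {cmonom I} -> Prop) :
  P mone -> (forall m i, P m -> P (mmul m (ucm i))) -> forall m, P m.
Proof.
move=> P1 PM m; have [n] := ubnP (mdeg m); elim: n m => // n IH m mn.
have [->//|m1] := eqVneq m mone.
have /existsNP[i /eqP mi] : ~ forall i, m i = (mone : {cmonom I}) i.
  by move=> /cmP; apply/negP.
rewrite cm1 in mi; have [k Ek] := cmonom_divU mi; rewrite {}Ek in mn *.
by apply/PM/IH; move: mn; rewrite mdegM mdegU addn1.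
Qed.

Lemma cmonom_swap k l i j : i != j -> mmul k (ucm i) = mmul l (ucm j) ->
  exists2 m, k = mmul m (ucm j) & l = mmul m (ucm i).
Proof.
move=> ij E; have [|m Em] := @cmonom_divU k j.
  apply: contraTneq isT => kj; have := congr1 (fun m : {cmonom I} => m j) E.
  by rewrite !cmM !cmU kj (negPf ij) eqxx addn1.
exists m => //; apply: (@cmonom_mulIm _ _ (ucm j)); rewrite -E Em.
by rewrite -!mulmA (mulmC (ucm i)).
Qed.

Lemma mkmalgU_int (c : int) m : mkmalgU m c = mkmalgU m 1 *~ c :> zpoly I.
Proof.
by rewrite -[in LHS](intz c) -(raddfMz (mkmalgU m)).
Qed.

Lemma zmonM k l :
  mkmalgU (mmul k l) 1 = mkmalgU k 1 * mkmalgU l 1 :> zpoly I.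
Proof. by rewrite malgM_def; symmetry; exact: fgmulUU. Qed.

Lemma mon_eval_zvar m : mon_eval (@zvar I) m = mkmalgU m 1.
Proof.
elim/cmonom_ind: m => [|m i IHm]; first by rewrite mmorph1 -mpolyC1E.
by rewrite mmorphM /= IHm mon_evalU zvarE [RHS]zmonM.
Qed.

Section LinearExtension.
Variables (V : zmodType) (g : {cmonom I} -> V).

Definition lin_ext (p : zpoly I) : V := \sum_(k <- msupp p) g k *~ p@_k.

Lemma lin_extEw (d : {fset {cmonom I}}) p : fsubset (msupp p) d ->
  lin_ext p = \sum_(k <- d) g k *~ p@_k.
Proof.
by move=> le; rewrite [LHS](big_fset_incl _ le) => //= k _ /mcoeff_outdom ->.
Qed.

Fact lin_ext_additive : zmod_morphism lin_ext.
Proof.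
move=> p q; pose d := (msupp p `|` msupp q `|` msupp (p - q))%fset.
have sub (t : zpoly I) : t \in [:: p; q; p - q] -> fsubset (msupp t) d.
  rewrite !inE => /or3P[]/eqP->; apply/fsubsetP => k kt; rewrite !in_fsetU kt ?orbT //.
rewrite (lin_extEw (sub (p - q) _)) ?(lin_extEw (sub p _)) ?(lin_extEw (sub q _))
  ?inE ?eqxx ?orbT //.
by rewrite -sumrB; apply: eq_bigr => k _; rewrite mcoeffB mulrzBr.
Qed.
HB.instance Definition _ := GRing.isZmodMorphism.Build _ _ lin_ext lin_ext_additive.

Lemma lin_extU m : lin_ext (mkmalgU m 1) = g m.
Proof. by rewrite (lin_extEw msuppU_le) big_seq_fset1 mcoeffUU mulr1z. Qed.
End LinearExtension.

Lemma zpoly_additive_eq (V : zmodType) (f g : {additive zpoly I -> V}) :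
  (forall m, f (mkmalgU m 1) = g (mkmalgU m 1)) -> f =1 g.
Proof.
move=> fg p; rewrite (monalgE p) !raddf_sum; apply: eq_bigr => m _ /=.
by rewrite mkmalgU_int !raddfMz /= fg.
Qed.

Lemma zpoly_rmorph_eq (R : comNzRingType) (f g : {rmorphism zpoly I -> R}) :
  (forall i, f (zvar i) = g (zvar i)) -> f =1 g.
Proof.
move=> fg; apply: zpoly_additive_eq => m; rewrite -mon_eval_zvar.
elim/cmonom_ind: m => [|m i IHm]; first by rewrite mmorph1 /= !rmorph1.
by rewrite mmorphM /= !rmorphM IHm mon_evalU fg.
Qed.

End Monomials.

(** * A module map modelled on the products of two families of variables *)

Section RankOne.
Variables (X : choiceType) (C : comNzRingType) (V : lmodType C).
Variables (q r : X -> C) (s : X -> X -> V).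
Hypothesis swapr : forall x y z, r z *: s x y = r y *: s x z.
Hypothesis swapl : forall x y z, q z *: s x y = q x *: s z y.

Definition qvar (x : X) : zpoly (X * bool)%type := zvar (x, true).
Definition rvar (x : X) : zpoly (X * bool)%type := zvar (x, false).

Let ev : {rmorphism zpoly (X * bool)%type -> C} := zeval (fun t => if t.2 then q t.1 else r t.1).
Let evm : {cmonom (X * bool)%type} -> C := mon_eval (fun t => if t.2 then q t.1 else r t.1).
Local Notation Uq x := (ucm (x, true)).
Local Notation Ur x := (ucm (x, false)).

Let evmM k l : evm (mmul k l) = evm k * evm l. Proof. exact: mmorphM. Qed.
Let evmq x : evm (Uq x) = q x. Proof. exact: mon_evalU. Qed.
Let evmr x : evm (Ur x) = r x. Proof. exact: mon_evalU. Qed.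

Let evm_swapr k l x y y' : mmul k (Ur y) = mmul l (Ur y') ->
  evm k *: s x y = evm l *: s x y'.
Proof.
have [<- /cmonom_mulIm -> //|yy'] := eqVneq y y'.
move=> /cmonom_swap [|m -> ->]; first by rewrite xpair_eqE (negPf yy').
by rewrite !evmM !evmr -!scalerA swapr.
Qed.

(** This gives independence of the decomposition of a monomial: [swapl] exchanges the q-variables,
    and [evm_swapr] then exchanges the r-variables. *)
Let evm_swap k l x y x' y' :
  mmul (mmul k (Ur y)) (Uq x) = mmul (mmul l (Ur y')) (Uq x') ->
  evm k *: s x y = evm l *: s x' y'.
Proof.
have [<- /cmonom_mulIm /evm_swapr -> //|xx'] := eqVneq x x'.
move=> /cmonom_swap[|d Ek El]; first by rewrite xpair_eqE (negPf xx').
have [|e -> Ed] := cmonom_swap _ Ek; first by rewrite xpair_eqE andbF.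
rewrite Ed in El; have [|g -> Eg] := cmonom_swap _ El.
  by rewrite xpair_eqE andbF.
rewrite !evmM !evmq -scalerA swapl !scalerA mulrC (mulrC _ (q x)) -!scalerA.
by congr (_ *: _); apply: evm_swapr; rewrite Eg.
Qed.

(* By the two relations, [s x y] behaves like the product [qvar x * rvar y]. *)
Lemma rank_one_map : exists sigma : {additive zpoly (X * bool)%type -> V},
  forall u x y, sigma (u * qvar x * rvar y) = ev u *: s x y.
Proof.
pose dec (m : {cmonom (X * bool)%type}) (t : {cmonom (X * bool)%type} * (X * X)) :=
  m = mmul (mmul t.1 (Ur t.2.2)) (Uq t.2.1).
(* Monomials divisible by no product q_x r_y go to 0; for the others [evm_swap] makes the chosen
   decomposition immaterial. *)
pose g m : V := if pselect (exists t, dec m t) is left h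
  then let t := sval (cid h) in evm t.1 *: s t.2.1 t.2.2 else 0.
have gE k x y : g (mmul (mmul k (Ur y)) (Uq x)) = evm k *: s x y.
  rewrite /g; case: pselect => [h|]; last by case; exists (k, (x, y)).
  by case: (cid h) => -[l [x' y']] /= /esym /evm_swap.
exists (lin_ext g) => u x y.
pose f1 (u : zpoly (X * bool)%type) := lin_ext g (u * qvar x * rvar y).
pose f2 (u : zpoly (X * bool)%type) := ev u *: s x y.
have f1B : zmod_morphism f1 by move=> u1 u2; rewrite /f1 !mulrBl raddfB.
have f2B : zmod_morphism f2.
  by move=> u1 u2; rewrite /f2 rmorphB scalerBl.
pose F1 : {additive zpoly (X * bool)%type -> V} :=
  HB.pack f1 (GRing.isZmodMorphism.Build _ _ f1 f1B).
pose F2 : {additive zpoly (X * bool)%type -> V} :=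
  HB.pack f2 (GRing.isZmodMorphism.Build _ _ f2 f2B).
apply: (@zpoly_additive_eq _ _ F1 F2) => m /=; rewrite /f1 /f2.
rewrite /qvar /rvar !zvarE -!zmonM lin_extU.
rewrite -mulmA (mulmC (Uq x)) mulmA gE.
by congr (_ *: _); exact/esym/(etrans (zevalU _ _ _))/mul1r.
Qed.

End RankOne.

(** * Faithfulness of the affine representation *)

Section Representation.
Variable B : skew_brace.

(* The pairs [(rho a, c a)] multiply componentwise under [sb_circ] and compose *)
(* as the affine maps [z |-> rho a - 1 + c a * z] under [sb_add].              *)
Record affine_rep (R : comNzRingType) (rho c : B -> R) : Prop := AffineRep {
  rep_rho0 : rho sb_zero = 1;
  rep_c0 : c sb_zero = 1;
  rep_rhoD : forall a b, rho (sb_add a b) = rho a + c a * (rho b - 1);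
  rep_cD : forall a b, c (sb_add a b) = c a * c b;
  rep_rhoM : forall a b, rho (sb_circ a b) = rho a * rho b;
  rep_cM : forall a b, c (sb_circ a b) = c a * c b }.

Hypothesis one_zero : @sb_one B = sb_zero.
Variables (R : comNzRingType) (rho c : B -> R) (rep : affine_rep rho c).

Lemma rep_cN a : c (sb_opp a) * c a = 1.
Proof. by rewrite -(rep_cD rep) (group_left_inv (sb_add_group B)) (rep_c0 rep). Qed.

Lemma rep_cV a : c (sb_inv a) * c a = 1.
Proof.
by rewrite -(rep_cM rep) (group_left_inv (sb_circ_group B)) one_zero (rep_c0 rep).
Qed.

Lemma rep_rhoV a : rho (sb_inv a) * rho a = 1.
Proof.
by rewrite -(rep_rhoM rep) (group_left_inv (sb_circ_group B)) one_zero (rep_rho0 rep).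
Qed.

Lemma rep_rhoN a : rho (sb_opp a) = 1 - c (sb_opp a) * (rho a - 1).
Proof.
apply/eqP; rewrite eq_sym subr_eq -(rep_rhoD rep).
by rewrite (group_left_inv (sb_add_group B)) (rep_rho0 rep).
Qed.

End Representation.

Section FaithfulRepresentation.
Variables (X : choiceType) (B : skew_brace) (i : X -> B).
Hypothesis one_zero : @sb_one B = sb_zero.
Hypothesis B_ind : forall P : B -> Prop, P sb_zero -> (forall x, P (i x)) ->
  (forall a b, P a -> P b -> P (sb_add a b)) -> (forall a, P a -> P (sb_opp a)) ->
  (forall a b, P a -> P b -> P (sb_circ a b)) -> (forall a, P a -> P (sb_inv a)) ->
  forall a, P a.
Variables (C : comNzRingType) (V : lmodType C) (rho c : B -> C) (s : B -> B -> V).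
Hypothesis rep : affine_rep rho c.
Hypothesis sDl : forall a a' b, s (sb_add a a') b = s a b + c a *: s a' b.
Hypothesis sDr : forall a b b', s a (sb_add b b') = s a b + c b *: s a b'.
Hypothesis sMl : forall a a' b,
  s (sb_circ a a') b = rho a' *: s a b + c a *: s a' b.
Hypothesis sMr : forall a b b', s a (sb_circ b b') = s a b + rho b *: s a b'.
Variables (L : fieldType) (hrho hc : B -> L) (hrep : affine_rep hrho hc).
Variables (P : comNzRingType) (qv rv : X -> P).
Variables (ev : {rmorphism P -> C}) (hev : {rmorphism P -> L}).
Hypothesis hev_inj : injective hev.
Hypothesis ev_q : forall x, ev (qv x) = rho (i x) - c (i x).
Hypothesis ev_r : forall x, ev (rv x) = rho (i x) - 1.
Hypothesis hev_q : forall x, hev (qv x) = hrho (i x) - hc (i x).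
Hypothesis hev_r : forall x, hev (rv x) = hrho (i x) - 1.
Variable sigma : {additive P -> V}.
Hypothesis sigmaE : forall u x y,
  sigma (u * qv x * rv y) = ev u *: s (i x) (i y).

Let hev_eq0 p : (hev p == 0) = (p == 0).
Proof. by rewrite -(rmorph0 hev) (inj_eq hev_inj). Qed.

(** The ideal generated by the products [qv x * rv y], on which [sigma] is linear over [P] through
    [ev] ([qr_ideal_mul]). *)
Inductive qr_ideal : P -> Prop :=
| qr_ideal0 : qr_ideal 0
| qr_idealD p u x y : qr_ideal p -> qr_ideal (p + u * qv x * rv y).

Let qr_ideal_add p p' : qr_ideal p -> qr_ideal p' -> qr_ideal (p + p').
Proof.
move=> Ip; elim=> [|{}p' u x y _ IH]; first by rewrite addr0.
by rewrite addrA; constructor.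
Qed.

Let qr_ideal_mul u p : qr_ideal p -> qr_ideal (u * p) /\ sigma (u * p) = ev u *: sigma p.
Proof.
elim=> [|{}p v x y _ [IH E]]; first by rewrite mulr0 raddf0 scaler0; split=> //; constructor.
have -> : u * (p + v * qv x * rv y) = u * p + u * v * qv x * rv y
  by rewrite mulrDr !mulrA.
split; first by constructor.
by rewrite !raddfD /= E !sigmaE rmorphM scalerA.
Qed.

(** The admissible denominators: they can be cancelled both in the field and in the module. *)
Let regular (d : P) := d != 0 /\ forall v : V, ev d *: v = 0 -> v = 0.

Let regular1 : regular 1.
Proof. by split=> [|v]; rewrite ?oner_eq0 // rmorph1 scale1r. Qed.
Let regularM d e : regular d -> regular e -> regular (d * e).
Proof.
move=> [d0 dV] [e0 eV]; split.
  by rewrite -hev_eq0 rmorphM mulf_neq0 ?hev_eq0.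
by move=> v; rewrite rmorphM -scalerA => /dV/eV.
Qed.

(* [theta] and [f] are both "equal to" the fraction [p / d]. *)
Let matches (theta : C) (f : L) := exists d p : P,
  [/\ regular d, ev d * theta = ev p & hev d * f = hev p].

Let matches_ev p : matches (ev p) (hev p).
Proof. by exists 1, p; rewrite !rmorph1 !mul1r. Qed.
Let matches1 : matches 1 1.
Proof. by rewrite -(rmorph1 ev) -(rmorph1 hev); apply: matches_ev. Qed.

Let matchesB theta eta f g :
  matches theta f -> matches eta g -> matches (theta - eta) (f - g).
Proof.
move=> [d [p [dr Ep Fp]]] [e [t [er Et Ft]]].
exists (d * e), (e * p - d * t); split; first exact: regularM.
  by rewrite rmorphB !rmorphM -Ep -Et; ring.
by rewrite rmorphB !rmorphM -Fp -Ft; ring.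
Qed.

Let matchesN theta f : matches theta f -> matches (- theta) (- f).
Proof.
move=> m; have := matchesB (matchesB m m) m.
by rewrite !subrr !sub0r.
Qed.

Let matchesD theta eta f g :
  matches theta f -> matches eta g -> matches (theta + eta) (f + g).
Proof.
by move=> mf mg; rewrite -[eta]opprK -[g]opprK; apply/matchesB/matchesN.
Qed.

Let matchesM theta eta f g :
  matches theta f -> matches eta g -> matches (theta * eta) (f * g).
Proof.
move=> [d [p [dr Ep Fp]]] [e [t [er Et Ft]]].
exists (d * e), (p * t); split; first exact: regularM.
  by rewrite !rmorphM -Ep -Et; ring.
by rewrite !rmorphM -Fp -Ft; ring.
Qed.

(** The inverse of p/d is d/p. Here [p] is an admissible denominator: it is nonzero because [f] is,
    and it acts injectively because [d] does and [theta] is invertible. *)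
Let matchesV theta eta f g : eta * theta = 1 -> g * f = 1 ->
  matches theta f -> matches eta g.
Proof.
move=> et gf [d [p [[d0 dr] Ep Fp]]]; exists p, d; split.
- split=> [|v pv].
    rewrite -hev_eq0 -Fp mulf_neq0 ?hev_eq0 //.
    by apply: contra_eq_neq gf => ->; rewrite mulr0 eq_sym oner_eq0.
  have : ev d *: v = 0.
    by rewrite -[ev d]mulr1 -et mulrC -mulrA (mulrC theta) Ep -scalerA pv scaler0.
  exact: dr.
- by rewrite -Ep -mulrA (mulrC theta) et mulr1.
- by rewrite -Fp -mulrA (mulrC f) gf mulr1.
Qed.

Let rep_matches a : matches (rho a) (hrho a) /\ matches (c a) (hc a).
Proof.
elim/B_ind: a => [|x|a b [ra ca] [rb cb]|a [ra ca]|a b [ra ca] [rb cb]|a [ra ca]].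
- by rewrite (rep_rho0 rep) (rep_c0 rep) (rep_rho0 hrep) (rep_c0 hrep).
- have mr : matches (rho (i x)) (hrho (i x)).
    have -> : rho (i x) = ev (rv x + 1).
      by rewrite rmorphD rmorph1 ev_r subrK.
    have -> : hrho (i x) = hev (rv x + 1) by rewrite rmorphD rmorph1 hev_r subrK.
    exact: matches_ev.
  split=> //; have -> : c (i x) = rho (i x) - ev (qv x) by rewrite ev_q opprB addrC subrK.
  have -> : hc (i x) = hrho (i x) - hev (qv x) by rewrite hev_q opprB addrC subrK.
  by apply: matchesB => //; apply: matches_ev.
- rewrite (rep_rhoD rep) (rep_rhoD hrep) (rep_cD rep) (rep_cD hrep).
  by split; [apply/matchesD/matchesM/matchesB|apply: matchesM].
- have mc := matchesV (rep_cN rep a) (rep_cN hrep a) ca.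
  rewrite (rep_rhoN rep) (rep_rhoN hrep); split=> //.
  by apply/matchesB/matchesM/matchesB.
- rewrite (rep_rhoM rep) (rep_rhoM hrep) (rep_cM rep) (rep_cM hrep).
  by split; apply: matchesM.
- split.
    exact: (matchesV (rep_rhoV one_zero rep a) (rep_rhoV one_zero hrep a) ra).
  exact: (matchesV (rep_cV one_zero rep a) (rep_cV one_zero hrep a) ca).
Qed.

(** The module version of [matches]: the numerator lies in the ideal and reaches V through
    [sigma]. *)
Let vmatches (v : V) (f : L) := exists d p : P,
  [/\ regular d, qr_ideal p, ev d *: v = sigma p & hev d * f = hev p].

Let vmatches0 : vmatches 0 0.
Proof.
by exists 1, 0; rewrite scaler0 mulr0 !raddf0; split=> //; constructor.
Qed.

Let vmatchesD v w f g : vmatches v f -> vmatches w g -> vmatches (v + w) (f + g).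
Proof.
move=> [d [p [dr Ip Ep Fp]]] [e [t [er It Et Ft]]].
have [Iep Eep] := qr_ideal_mul e Ip; have [Idt Edt] := qr_ideal_mul d It.
exists (d * e), (e * p + d * t); split; [exact: regularM|exact: qr_ideal_add| |].
  rewrite (raddfD sigma) Eep Edt -Ep -Et scalerDr !scalerA rmorphM.
  by rewrite (mulrC (ev e)).
by rewrite rmorphD !rmorphM -Fp -Ft; ring.
Qed.

Let vmatchesZ theta v f g :
  matches theta f -> vmatches v g -> vmatches (theta *: v) (f * g).
Proof.
move=> [d [p [dr Ep Fp]]] [e [t [er It Et Ft]]].
have [Ipt Ept] := qr_ideal_mul p It.
exists (d * e), (p * t); split; [exact: regularM|by []| |].
  rewrite Ept -Et -Ep !scalerA rmorphM; congr (_ *: _); ring.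
by rewrite !rmorphM -Fp -Ft; ring.
Qed.

Let vmatchesN v f : vmatches v f -> vmatches (- v) (- f).
Proof.
by move=> /(vmatchesZ (matchesN matches1)); rewrite scaleN1r mulN1r.
Qed.

(** Injectivity of [hev] forces the numerator to be 0, and the regular denominator is then
    cancelled. *)
Let vmatches_eq0 v : vmatches v 0 -> v = 0.
Proof.
move=> [d [p [[_ dr] _ Ep]]]; rewrite mulr0 => /esym/eqP; rewrite hev_eq0 => /eqP p0.
by apply: dr; rewrite Ep p0 raddf0.
Qed.

Let s0l b : s sb_zero b = 0.
Proof.
have := sDl sb_zero sb_zero b; rewrite (group_left_id (sb_add_group B)).
by rewrite (rep_c0 rep) scale1r => /eqP; rewrite -subr_eq0 opprD addrA subrr sub0r oppr_eq0
  => /eqP.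
Qed.
Let s0r a : s a sb_zero = 0.
Proof.
have := sDr a sb_zero sb_zero; rewrite (group_left_id (sb_add_group B)).
by rewrite (rep_c0 rep) scale1r => /eqP; rewrite -subr_eq0 opprD addrA subrr sub0r oppr_eq0 => /eqP.
Qed.

Let sNl a b : s (sb_opp a) b = - (c (sb_opp a) *: s a b).
Proof.
apply/eqP; rewrite -subr_eq0 opprK -sDl.
by rewrite (group_left_inv (sb_add_group B)) s0l.
Qed.
Let sNr a b : s a (sb_opp b) = - (c (sb_opp b) *: s a b).
Proof.
apply/eqP; rewrite -subr_eq0 opprK -sDr.
by rewrite (group_left_inv (sb_add_group B)) s0r.
Qed.
Let sVl a b : s (sb_inv a) b = - (rho (sb_inv a) *: (c (sb_inv a) *: s a b)).
Proof.
have := sMl (sb_inv a) a b.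
rewrite (group_left_inv (sb_circ_group B)) one_zero s0l => /esym/eqP.
rewrite addr_eq0 => /eqP/(congr1 (fun v => rho (sb_inv a) *: v)).
by rewrite scalerA (rep_rhoV one_zero rep) scale1r scalerN.
Qed.
Let sVr a b : s a (sb_inv b) = - (rho (sb_inv b) *: s a b).
Proof.
have := sMr a (sb_inv b) b.
rewrite (group_left_inv (sb_circ_group B)) one_zero s0r => /esym/eqP.
by rewrite addr_eq0 => /eqP.
Qed.

Let hq a := hrho a - hc a.
Let hr a := hrho a - 1.

(** Both sides obey the same expansion rules for sums, products and inverses in each argument, so
    induction on [b] and then on [a] reduces to generators, where [sigmaE] gives the match. *)
Let s_matches a b : vmatches (s a b) (hq a * hr b).
Proof.
have mr t := (rep_matches t).1; have mc t := (rep_matches t).2.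
elim/B_ind: b a => [|y|b b' IHb IHb'|b IHb|b b' IHb IHb'|b IHb] a.
- by rewrite s0r /hr (rep_rho0 hrep) subrr mulr0; apply: vmatches0.
- elim/B_ind: a => [|x|a a' IHa IHa'|a IHa|a a' IHa IHa'|a IHa].
  + by rewrite s0l /hq (rep_rho0 hrep) (rep_c0 hrep) subrr mul0r; apply: vmatches0.
  + exists 1, (0 + 1 * qv x * rv y); split=> //; first by do !constructor.
      by rewrite add0r sigmaE.
    by rewrite add0r rmorph1 !mul1r rmorphM hev_q hev_r.
  + have -> : hq (sb_add a a') * hr (i y) = hq a * hr (i y) + hc a * (hq a' * hr (i y)).
      by rewrite /hq (rep_rhoD hrep) (rep_cD hrep); ring.
    by rewrite sDl; apply/vmatchesD/vmatchesZ.
  + have -> : hq (sb_opp a) * hr (i y) = - (hc (sb_opp a) * (hq a * hr (i y))).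
      have -> : hq (sb_opp a) = - (hc (sb_opp a) * hq a).
        rewrite /hq (rep_rhoN hrep) -{1}(rep_cN hrep a).
        by set c1 := hc (sb_opp a); ring.
      by ring.
    by rewrite sNl; apply/vmatchesN/vmatchesZ.
  + have -> : hq (sb_circ a a') * hr (i y) =
        hrho a' * (hq a * hr (i y)) + hc a * (hq a' * hr (i y)).
      by rewrite /hq (rep_rhoM hrep) (rep_cM hrep); ring.
    by rewrite sMl; apply: vmatchesD; apply: vmatchesZ.
  + have -> : hq (sb_inv a) * hr (i y) =
        - (hrho (sb_inv a) * (hc (sb_inv a) * (hq a * hr (i y)))).
      have r1 := rep_rhoV one_zero hrep a; have c1 := rep_cV one_zero hrep a.
      have -> : hq (sb_inv a) = - (hrho (sb_inv a) * hc (sb_inv a) * hq a).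
        transitivity (hrho (sb_inv a) * (hc (sb_inv a) * hc a) -
                      hc (sb_inv a) * (hrho (sb_inv a) * hrho a)).
          by rewrite r1 c1 !mulr1.
        by rewrite /hq; ring.
      by ring.
    by rewrite sVl; apply/vmatchesN/vmatchesZ/vmatchesZ.
- have -> : hq a * hr (sb_add b b') = hq a * hr b + hc b * (hq a * hr b').
    by rewrite /hr (rep_rhoD hrep); ring.
  by rewrite sDr; apply/vmatchesD/vmatchesZ.
- have -> : hq a * hr (sb_opp b) = - (hc (sb_opp b) * (hq a * hr b)).
    by rewrite /hr (rep_rhoN hrep); ring.
  by rewrite sNr; apply/vmatchesN/vmatchesZ.
- have -> : hq a * hr (sb_circ b b') = hq a * hr b + hrho b * (hq a * hr b').
    by rewrite /hr (rep_rhoM hrep); ring.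
  by rewrite sMr; apply/vmatchesD/vmatchesZ.
- have -> : hq a * hr (sb_inv b) = - (hrho (sb_inv b) * (hq a * hr b)).
    have r1 := rep_rhoV one_zero hrep b.
    have -> : hr (sb_inv b) = - (hrho (sb_inv b) * hr b).
      by rewrite /hr mulrBr r1; ring.
    by ring.
  by rewrite sVr; apply/vmatchesN/vmatchesZ.
Qed.

(** The graph of the additive map sending [s a b] to its product. It is a relation because an
    element may be a combination of stars in several ways. *)
Inductive linked : V -> L -> Prop :=
| linked0 : linked 0 0
| linked_s a b : linked (s a b) ((hrho a - hc a) * (hrho b - 1))
| linkedD v w f g : linked v f -> linked w g -> linked (v + w) (f + g)
| linkedN v f : linked v f -> linked (- v) (- f).

Lemma linked_eq0 v : linked v 0 -> v = 0.
Proof.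
suff H f : linked v f -> vmatches v f by move=> /H/vmatches_eq0.
by elim=> *; [apply: vmatches0|apply: s_matches|apply: vmatchesD|apply: vmatchesN].
Qed.

End FaithfulRepresentation.

(** * The affine skew brace over F(t) *)

Section AffineBrace.
Variables (L : fieldType) (G : L -> Prop).
Hypothesis G_neq0 : forall x, G x -> x != 0.
Hypothesis G1 : G 1.
Hypothesis GM : forall x y, G x -> G y -> G (x * y).
Hypothesis GV : forall x, G x -> G x^-1.
Hypothesis GA : forall x y z, G x -> G y -> G z -> G (x + y * (z - 1)).

Definition affine_pair : Type := {x : L * L | G x.1 /\ G x.2}.
Local Notation T := affine_pair.

Let eqT (x y : T) : (sval x).1 = (sval y).1 -> (sval x).2 = (sval y).2 -> x = y.
Proof.
case: x y => [[x1 x2] Gx] [[y1 y2] Gy] /= E1 E2; rewrite {}E1 {}E2 in Gx *.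
by congr exist; apply: Prop_irrelevance.
Qed.

Definition affine_add (x y : T) : T :=
  exist _ ((sval x).1 + (sval x).2 * ((sval y).1 - 1), (sval x).2 * (sval y).2)
    (conj (GA (svalP x).1 (svalP x).2 (svalP y).1) (GM (svalP x).2 (svalP y).2)).

Fact affine_oppP (x : T) :
  G (1 - (sval x).2^-1 * ((sval x).1 - 1)) /\ G (sval x).2^-1.
Proof.
case: x => -[p c] /= [Gp Gc]; split; last exact: GV.
(* The identity used is 1 - c^-1 (p - 1) = p (p^-1 + c^-1 (p^-1 - 1)). *)
have := GM Gp (GA (GV Gp) (GV Gc) (GV Gp)); congr G.
by field; rewrite !G_neq0.
Qed.
Definition affine_opp (x : T) : T := exist _ (_, _) (affine_oppP x).

Definition affine_zero : T := exist _ (1, 1) (conj G1 G1).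

Definition affine_circ (x y : T) : T :=
  exist _ ((sval x).1 * (sval y).1, (sval x).2 * (sval y).2)
    (conj (GM (svalP x).1 (svalP y).1) (GM (svalP x).2 (svalP y).2)).

Definition affine_inv (x : T) : T :=
  exist _ ((sval x).1^-1, (sval x).2^-1)
    (conj (GV (svalP x).1) (GV (svalP x).2)).

Fact affine_add_group : is_group affine_add affine_zero affine_opp.
Proof.
have c0 (x : T) : (sval x).2 != 0 by apply: G_neq0 (svalP x).2.
split.
- by move=> x y z; apply: eqT => /=; ring.
- by move=> x; apply: eqT => /=; ring.
- by move=> x; apply: eqT => /=; ring.
- by move=> x; apply: eqT => /=; field; apply: c0.
- by move=> x; apply: eqT => /=; field; apply: c0.
Qed.

Fact affine_circ_group : is_group affine_circ affine_zero affine_inv.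
Proof.
have p0 (x : T) : (sval x).1 != 0 by apply: G_neq0 (svalP x).1.
have c0 (x : T) : (sval x).2 != 0 by apply: G_neq0 (svalP x).2.
split.
- by move=> x y z; apply: eqT; rewrite /= mulrA.
- by move=> x; apply: eqT; rewrite /= mul1r.
- by move=> x; apply: eqT; rewrite /= mulr1.
- by move=> x; apply: eqT; rewrite /= mulVf.
- by move=> x; apply: eqT; rewrite /= mulfV.
Qed.

Fact affine_compat (a b c : T) : affine_circ a (affine_add b c) =
  affine_add (affine_add (affine_circ a b) (affine_opp a)) (affine_circ a c).
Proof.
have c0 (x : T) : (sval x).2 != 0 by apply: G_neq0 (svalP x).2.
by apply: eqT => /=; field; apply: c0.
Qed.

Definition affine_brace : skew_brace :=
  SkewBrace affine_add_group affine_circ_group affine_compat.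

Lemma affine_brace_commutative : commutative_skew_brace affine_brace.
Proof. by move=> x y; apply: eqT; rewrite /= mulrC. Qed.

Lemma affine_hom_rep (B : skew_brace) (phi : B -> affine_brace) :
  skew_brace_hom phi ->
  affine_rep (fun b => (sval (phi b)).1) (fun b => (sval (phi b)).2).
Proof.
case=> phiD phiM; have c1 : (sval (phi sb_zero)).2 = 1.
  have c0 : (sval (phi sb_zero)).2 != 0 by apply: G_neq0 (svalP (phi _)).2.
  apply: (mulfI c0); rewrite mulr1 -[in RHS](group_left_id (sb_add_group B) sb_zero).
  by rewrite phiD.
split=> [||a b|a b|a b|a b]; rewrite ?phiD ?phiM //.
have := congr1 (fun x : affine_brace => (sval x).1) (phiD sb_zero sb_zero).
rewrite (group_left_id (sb_add_group B)) /= c1 mul1r => /eqP.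
by rewrite -subr_eq0 opprD addrA subrr sub0r oppr_eq0 subr_eq0 => /eqP.
Qed.

End AffineBrace.

(** * Generic rational functions for the generators *)

Lemma unit_at0_linear (F : fieldType) (u v : {fraction {poly F}}) (a b : F) :
  u = tofrac (a *: 'X) -> v = tofrac (b *: 'X) ->
  unit_at0 (1 + v) /\ unit_at0 (1 + v - u).
Proof.
move=> -> ->; rewrite -tofrac1 -tofracD -tofracB.
split; apply: unit_at0_frac.
  by rewrite hornerD hornerZ hornerX mulr0 hornerC addr0.
by rewrite !hornerD hornerN !hornerZ hornerX !mulr0 hornerC oppr0 !addr0.
Qed.

Section FreeModel.
Variable X : choiceType.
Local Notation P := (zpoly (X * bool)%type).

(** Each variable is sent to t times its image in the fraction field F. Setting t = 1 recovers the
    inclusion into F, hence injectivity; setting t = 0 kills the variables, hence the value 1. *)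
Lemma free_model_exists :
  exists (F : fieldType) (hev : {rmorphism P -> {fraction {poly F}}}),
  injective hev /\ forall x, unit_at0 (1 + hev (rvar x)) /\
    unit_at0 (1 + hev (rvar x) - hev (qvar x)).
Proof.
have [F [f f_inj]] := fraction_field_exists (@zpoly_idomain (X * bool)%type).
pose w : {rmorphism P -> {poly F}} := zeval (fun t => f (zvar t) *: 'X).
have wE t : w (zvar t) = f (zvar t) *: 'X by exact: zeval_var.
have w1 p : (w p).[1] = f p.
  have := @zpoly_rmorph_eq _ _ (horner_eval 1 \o w) f.
  by apply=> t; rewrite /= horner_evalE wE hornerZ hornerX mulr1.
have [hev [hev_inj hevE]] : exists hev : {rmorphism P -> {fraction {poly F}}},
    injective hev /\ forall t, hev (zvar t) = tofrac (f (zvar t) *: 'X).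
  exists (@tofrac _ \o w); split=> [|t]; last by rewrite /= wE.
  apply: raddf_inj => p /eqP; rewrite tofrac_eq0 => /eqP wp0.
  by apply: f_inj; rewrite rmorph0 -w1 wp0 horner0.
clear w wE w1; exists F, hev; split=> //.
by move=> x; apply: unit_at0_linear (hevE _) (hevE _).
Qed.

Lemma qrvar_neq0 (L : fieldType) (hev : {rmorphism P -> L}) (x : X) :
  injective hev -> hev (qvar x) * hev (rvar x) != 0.
Proof.
move=> hinj; have vn t : hev (zvar t) != 0.
  by rewrite -(rmorph0 hev) (inj_eq hinj) zvarE monalgU_eq0 oner_eq0.
by rewrite mulf_neq0 ?vn.
Qed.

End FreeModel.

(** The generators are sent to the disjoint union, and the coefficients at [inl x] and [inr x]
    recover the two components. *)
Lemma freeg_sum_embedding (K1 K2 : choiceType) :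
  exists f : {freeg K1 / int} -> {freeg K2 / int} -> {freeg (K1 + K2)%type / int},
  (forall D1 D2 E1 E2, f (D1 + D2) (E1 + E2) = f D1 E1 + f D2 E2) /\
  (forall D E, f D E = 0 -> D = 0 /\ E = 0).
Proof.
pose g (K : choiceType) (j : K -> (K1 + K2)%type) (D : {freeg K / int}) :
  {freeg (K1 + K2)%type / int} := fglift (fun x => [freeg [:: (1, j x)]]) D.
have gB K j : zmod_morphism (@g K j) by exact: lift_is_additive.
have g0 K j : @g K j 0 = 0 by rewrite -[in LHS](subrr 0) gB subrr.
have gN K j D : @g K j (- D) = - g K j D by rewrite -sub0r gB g0 sub0r.
have gD K j D E : @g K j (D + E) = g K j D + g K j E.
  by rewrite -[in LHS](opprK E) gB gN opprK.
have gU K j n x : @g K j [freeg [:: (n, x)]] = [freeg [:: (n, j x)]].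
  by rewrite /g liftU -[n in LHS]intz scaler_int freeg_mulz intz.
have gc (K : choiceType) (j : K -> (K1 + K2)%type) x D : injective j ->
    coeff (j x) (g K j D) = coeff x D.
  move=> j_inj; elim/freeg_ind_dom0: D => [|n y D _ _ IH]; first by rewrite g0 !coeff0.
  by rewrite gD !coeffD IH gU !coeffU (inj_eq j_inj).
have gc0 (K : choiceType) (j : K -> (K1 + K2)%type) t D : (forall x, j x != t) ->
    coeff t (g K j D) = 0.
  move=> jt; elim/freeg_ind_dom0: D => [|n y D _ _ IH]; first by rewrite g0 !coeff0.
  by rewrite gD !coeffD IH gU !coeffU (negPf (jt y)) mulr0 addr0.
exists (fun D E => g K1 inl D + g K2 inr E); split=> [D1 D2 E1 E2|D E E0].
  by rewrite !gD !addrA (addrAC (g K1 inl D1)).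
split; apply/eqP/freeg_eqP => x; rewrite coeff0.
  have := congr1 (coeff (inl x)) E0; rewrite coeff0 coeffD gc ?gc0 ?addr0 //.
  by move=> ? ? [].
have := congr1 (coeff (inr x)) E0; rewrite coeff0 coeffD gc0 ?gc ?add0r //.
by move=> ? ? [].
Qed.

(** * Abelian groups as skew braces *)

Section TrivialBrace.
Variable A : zmodType.

Fact trivial_group : is_group (+%R : A -> A -> A) 0 -%R.
Proof.
split; [exact: addrA|exact: add0r|exact: addr0|exact: addNr|exact: addrN].
Qed.

Fact trivial_compat (a b c : A) : a + (b + c) = a + b - a + (a + c).
Proof. by rewrite [RHS]addrA addrNK addrA. Qed.

Definition trivial_brace : skew_brace :=
  SkewBrace trivial_group trivial_group trivial_compat.

Lemma trivial_brace_commutative : commutative_skew_brace trivial_brace.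
Proof. exact: addrC. Qed.
End TrivialBrace.

Section AffineRepStar.
Variables (B : skew_brace) (L : fieldType) (rho c : B -> L).
Hypothesis rep : affine_rep rho c.

(** Since stars have multiplier 1, [rho - 1] is additive on M; its values on generators of M are the
    products used in [linked]. *)
Lemma rep_star a b :
  rho (star a b) - 1 = (rho a - c a) * (rho b - 1) /\ c (star a b) = 1.
Proof.
have ca := rep_cN rep a; have cb := rep_cN rep b.
rewrite /star !(rep_rhoD rep, rep_rhoN rep, rep_cD rep, rep_rhoM rep, rep_cM rep).
move: ca cb; move: (c (sb_opp a)) (c (sb_opp b)) => ia ib ca cb.
have ca0 : c a != 0 by apply: contra_eq_neq ca => ->; rewrite mulr0 eq_sym oner_eq0.
have cb0 : c b != 0 by apply: contra_eq_neq cb => ->; rewrite mulr0 eq_sym oner_eq0.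
have -> : ia = (c a)^-1 by apply: (mulIf ca0); rewrite ca mulVf.
have -> : ib = (c b)^-1 by apply: (mulIf cb0); rewrite cb mulVf.
by split; field; rewrite ca0 cb0.
Qed.
End AffineRepStar.

(** * Consequences of the universal property *)

Section FreeBrace.
Variables (X : Type) (B : skew_brace) (i : X -> B).
Hypothesis hfree : free_commutative_skew_brace i.
Let hB : commutative_skew_brace B := hfree.1.

Lemma free_hom_eq (K : skew_brace) (phi psi : B -> K) :
  commutative_skew_brace K -> skew_brace_hom phi -> skew_brace_hom psi ->
  phi \o i =1 psi \o i -> phi =1 psi.
Proof.
move=> hK hphi hpsi E; have [chi [_ _ U]] := hfree.2 K hK (phi \o i).
by move=> b; rewrite (U phi hphi) // (U psi hpsi).
Qed.

(** The elements satisfying [P] form a commutative sub-brace containing the generators. Freeness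
    maps B into it, and the composite with the inclusion is the identity by uniqueness. *)
Lemma free_ind (P : B -> Prop) :
  P sb_zero -> (forall x, P (i x)) ->
  (forall a b, P a -> P b -> P (sb_add a b)) -> (forall a, P a -> P (sb_opp a)) ->
  (forall a b, P a -> P b -> P (sb_circ a b)) -> (forall a, P a -> P (sb_inv a)) ->
  forall a, P a.
Proof.
move=> P0 Pi PD PN PM PV.
pose T := {b : B | P b}.
have eqT (x y : T) : sval x = sval y -> x = y.
  case: x y => [x Px] [y Py] /= E; rewrite {}E in Px *.
  by congr exist; apply: Prop_irrelevance.
pose add (x y : T) : T := exist _ _ (PD _ _ (svalP x) (svalP y)).
pose opp (x : T) : T := exist _ _ (PN _ (svalP x)).
pose circ (x y : T) : T := exist _ _ (PM _ _ (svalP x) (svalP y)).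
pose inv (x : T) : T := exist _ _ (PV _ (svalP x)).
pose zero : T := exist _ _ P0.
have P1 : P sb_one by rewrite sb_one_zero.
pose one : T := exist _ _ P1.
have addG : is_group add zero opp.
  have G := sb_add_group B.
  by split=> [x y z|x|x|x|x]; apply: eqT => /=; [exact: (group_assoc G)
    |exact: (group_left_id G)|exact: (group_right_id G)
    |exact: (group_left_inv G)|exact: (group_right_inv G)].
have circG : is_group circ one inv.
  have G := sb_circ_group B.
  by split=> [x y z|x|x|x|x]; apply: eqT => /=; [exact: (group_assoc G)
    |exact: (group_left_id G)|exact: (group_right_id G)
    |exact: (group_left_inv G)|exact: (group_right_inv G)].
have compat (a b c : T) : circ a (add b c) = add (add (circ a b) (opp a)) (circ a c).
  by apply: eqT; exact: sb_compat.
pose K := SkewBrace addG circG compat.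
have hK : commutative_skew_brace K by move=> x y; apply: eqT; exact: hB.
have [phi [[phiD phiM] phii _]] := hfree.2 K hK (fun x => exist _ _ (Pi x)).
have E : (fun b => sval (phi b)) =1 id.
  apply: free_hom_eq => //.
  - by split=> a b; rewrite ?phiD ?phiM.
  - by move=> x /=; rewrite -[phi (i x)]/((phi \o i) x) -phii.
by move=> a; rewrite -[a]E; exact: svalP (phi a).
Qed.

(** The homomorphism extends the basis map from X to Z^X, viewed as a trivial brace. By uniqueness
    the projection to B/M factors through it, so degree 0 implies membership in M. *)
Lemma degree_exists : exists deg : B -> {freeg {classic X} / int},
  {morph deg : a b / sb_circ a b >-> a + b} /\
  forall b, deg b = 0 -> in_stars b.
Proof.
pose A := {freeg {classic X} / int}.
have [deg [[degD degM] degi _]] := hfree.2 (trivial_brace A)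
  (@trivial_brace_commutative A) (fun x => [freeg [:: (1, x : {classic X})]]).
exists deg; split=> // b b0; apply: (star_pi_eq0 (hB := hB)).
pose Q : lmodType int := zmodule (star_quotient hB).
pose l : A -> Q := fglift (fun x : {classic X} => star_pi hB (i x) : Q).
have lB : zmod_morphism l by exact: lift_is_additive.
have l0 : l 0 = 0 by rewrite -[in LHS](subrr 0) lB subrr.
have lD : {morph l : D E / D + E}.
  move=> D E; have lN F : l (- F) = - l F by rewrite -sub0r lB l0 sub0r.
  by rewrite -[in LHS](opprK E) lB lN opprK.
have E : star_pi hB =1 (l \o deg : B -> trivial_brace (star_quotient hB)).
  apply: (@free_hom_eq (trivial_brace (star_quotient hB))).
  - exact: trivial_brace_commutative.
  - by split=> x y; [exact: star_piD|exact: star_piM].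
  - by split=> x y; rewrite /= ?degD ?degM; exact: lD.
  - move=> x /=; rewrite -[deg (i x)]/((deg \o i) x) -degi.
    by rewrite /l liftU scale1r.
by rewrite E /= b0.
Qed.

End FreeBrace.

(** * The free commutative skew brace *)

Section FreeBraceEmbedding.
Variables (X : Type) (x0 : X) (B : skew_brace) (i : X -> B).
Hypothesis hfree : free_commutative_skew_brace i.
Let hB : commutative_skew_brace B := hfree.1.

Lemma free_rational_map : exists (F : fieldType) (h : B -> {fraction {poly F}}),
  [/\ forall b, unit_at0 (h b), {morph h : a b / sb_circ a b >-> a * b}
    & forall b, in_stars b -> h b = 1 -> b = sb_zero].
Proof.
have [F [hev [hev_inj hev_unit]]] := free_model_exists {classic X}.
have unit1 : unit_at0 (1 : {fraction {poly F}}).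
  by rewrite -tofrac1; apply: unit_at0_frac; rewrite hornerC.
pose K := affine_brace (@unit_at0_neq0 F) unit1 (@unit_at0M F) (@unit_at0V F)
  (@unit_at0_affine F).
pose f (x : X) : K := exist _ (1 + hev (rvar (x : {classic X})),
  1 + hev (rvar (x : {classic X})) - hev (qvar (x : {classic X}))) (hev_unit x).
have hK : commutative_skew_brace K by exact: affine_brace_commutative.
have [phi [hphi phii _]] := hfree.2 K hK f.
have [hrho [hc [hrep phiP phiE]]] : exists hrho hc : B -> {fraction {poly F}},
  [/\ affine_rep hrho hc, forall b, unit_at0 (hrho b)
    & forall x : {classic X}, hrho (i x) = 1 + hev (rvar x) /\
        hc (i x) = 1 + hev (rvar x) - hev (qvar x)].
  exists (fun b => (sval (phi b)).1), (fun b => (sval (phi b)).2); split=> [|b|x].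
  - exact: affine_hom_rep hphi.
  - exact: (svalP (phi b)).1.
  - by rewrite -[phi (i x)]/((phi \o i) x) -phii.
clear phi hphi phii hK f K.
have hev_r (x : {classic X}) : hev (rvar x) = hrho (i x) - 1.
  by rewrite (phiE x).1 addrC addKr.
have hev_q (x : {classic X}) : hev (qvar x) = hrho (i x) - hc (i x).
  have [-> ->] := phiE x; exact/esym/subKr.
(* This product is [hrho - 1] at the star of [i x0] with itself, so that star is nonzero; hence M is
   nonzero and its operator ring is nontrivial. *)
have nz : (hrho (i x0) - hc (i x0)) * (hrho (i x0) - 1) != 0.
  rewrite -(hev_q (x0 : {classic X})) -(hev_r (x0 : {classic X})).
  exact: qrvar_neq0 hev_inj.
exists F, hrho; split=> //; first exact: rep_rhoM hrep.
pose theta (t : B + B) : star_module hB -> star_module hB :=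
  match t with inl a => @rho B hB a | inr a => @cj B hB a end.
have thetaB t : {morph theta t : x y / x - y}.
  by case: t => a; [exact: rhoB|exact: cjB].
have thetaC t u x : theta t (theta u x) = theta u (theta t x).
  case: t u => a [] b.
  - exact: rho_comm.
  - exact: rho_cj.
  - exact/esym/rho_cj.
  - exact: cj_comm.
have star_neq0 : exists m : star_module hB, m <> 0.
  exists (starM hB (i x0) (i x0)).
  move=> E.
  have {}E : star (i x0) (i x0) = sb_zero.
    have := congr1 (@star_val B hB) E.
    exact.
  have [Er _] := rep_star hrep (i x0) (i x0).
  move: nz; rewrite -Er.
  rewrite E.
  rewrite (rep_rho0 hrep).
  by rewrite subrr eqxx.
have [C [V [j [g [j_bij jB jE C_faithful]]]]] := commuting_operators thetaB thetaC star_neq0.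
have j0 : j 0 = 0 by rewrite -[in LHS](subrr 0) jB subrr.
have jN m : j (- m) = - j m by rewrite -sub0r jB j0 sub0r.
have jD m m' : j (m + m') = j m + j m' by rewrite -[in LHS](opprK m') jB jN opprK.
pose rhoC a := g (inl a); pose cC a := g (inr a).
have rhoE a m : rhoC a *: j m = j (rho a m) by rewrite -jE.
have cE a m : cC a *: j m = j (cj a m) by rewrite -jE.
have C_eq (x y : C) : (forall m, x *: j m = y *: j m) -> x = y.
  by move=> xy; apply: C_faithful => v; have [k _ jk] := j_bij; rewrite -(jk v).
have one_zero : @sb_one B = sb_zero by exact: sb_one_zero.
have rep : affine_rep rhoC cC.
  split=> [||a b|a b|a b|a b]; apply: C_eq => m; rewrite ?scale1r ?rhoE ?cE.
  - by rewrite rho0.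
  - by rewrite cj0.
  - by rewrite rhoD scalerDl -scalerA scalerBl scale1r !rhoE -jB cE -jD cjB addrA addrAC.
  - by rewrite -scalerA !cE cjD.
  - by rewrite -scalerA !rhoE rho_circ rho_comm.
  - by rewrite -scalerA !cE cj_circ.
pose s a b := j (starM hB a b).
have sDl a a' b : s (sb_add a a') b = s a b + cC a *: s a' b.
  by rewrite /s starMDl jD cE.
have sDr a b b' : s a (sb_add b b') = s a b + cC b *: s a b'.
  by rewrite /s starMDr jD cE.
have sMl a a' b : s (sb_circ a a') b = rhoC a' *: s a b + cC a *: s a' b.
  by rewrite /s starM_circDl jD rhoE cE.
have sMr a b b' : s a (sb_circ b b') = s a b + rhoC b *: s a b'.
  by rewrite /s starM_circDr jD rhoE.
have swapr a b b' : (rhoC b' - 1) *: s a b = (rhoC b - 1) *: s a b'.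
  by rewrite /s !scalerBl !scale1r !rhoE -!jB starM_swapr.
have swapl a b a' : (rhoC a' - cC a') *: s a b = (rhoC a - cC a) *: s a' b.
  by rewrite /s !scalerBl !rhoE !cE -!jB starM_swapl.
have [sigma sigmaE] := @rank_one_map {classic X} C V
  (fun x => rhoC (i x) - cC (i x)) (fun x => rhoC (i x) - 1)
  (fun x y => s (i x) (i y)) (fun x y z => swapr (i x) (i y) (i z))
  (fun x y z => swapl (i x) (i y) (i z)).
pose t (x : ({classic X} * bool)%type) : C :=
  if x.2 then rhoC (i x.1) - cC (i x.1) else rhoC (i x.1) - 1.
have inj0 := @linked_eq0 {classic X} B i one_zero (free_ind hfree) C V rhoC cC s
  rep sDl sDr sMl sMr _ hrho hc hrep _ (@qvar _) (@rvar _) (zeval t) hev hev_inj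
  (fun x => zeval_var t (x, true)) (fun x => zeval_var t (x, false)) hev_q hev_r
  sigma sigmaE.
(* The two claims go together: the multiplier 1 is what makes [hrho - 1] additive in the sum and
   negation cases. *)
have link b : in_stars b -> hc b = 1 /\ forall m : star_module hB,
    star_val m = b -> linked s hrho hc (j m) (hrho b - 1).
  elim=> [|a b'|a b' Sa [ca la] Sb [cb lb]|a Sa [ca la]].
  - split=> [|m m0]; first exact: rep_c0 hrep.
    have -> : m = 0 by apply: star_val_inj.
    by rewrite j0 (rep_rho0 hrep) subrr; constructor.
  - have [Er Ec] := rep_star hrep a b'; split=> // m mE.
    have -> : m = starM hB a b' by apply: star_val_inj.
    by rewrite Er; exact: linked_s.
  - split=> [|m mE]; first by rewrite (rep_cD hrep) ca cb mulr1.
    have -> : m = mk_star hB Sa + mk_star hB Sb by apply: star_val_inj.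
    rewrite jD (rep_rhoD hrep) ca mul1r addrAC.
    by apply: linkedD; [exact: la|exact: lb].
  - have ca' : hc (sb_opp a) = 1 by have := rep_cN hrep a; rewrite ca mulr1.
    split=> // m mE; have -> : m = - mk_star hB Sa by apply: star_val_inj.
    rewrite jN (rep_rhoN hrep) ca' mul1r addrAC subrr sub0r.
    by apply: linkedN; exact: la.
move=> b Sb hb; have [_ /(_ (mk_star hB Sb) erefl)] := link b Sb.
rewrite hb subrr => /inj0 jb0; have [k jk _] := j_bij.
have /(congr1 (@star_val B hB)) : mk_star hB Sb = 0.
  by rewrite -[LHS]jk jb0 -j0 jk.
by [].
Qed.

End FreeBraceEmbedding.

Theorem proposition7p10 (X : Type) (hX : inhabited X)
    (B : skew_brace) (i : X -> B)
    (hfree : free_commutative_skew_brace i) :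
  free_abelian (@sb_circ B).
Proof.
have [x0] := hX.
have [F [h [h_unit hM h_inj]]] := free_rational_map x0 hfree.
have [deg [degM deg_inj]] := degree_exists hfree.
have [v [vM v_inj]] := unit_at0_free F.
have [f [fD f_inj]] := freeg_sum_embedding {classic X} {poly F}.
pose e b := f (deg b) (v (h b)).
have eM : {morph e : a b / sb_circ a b >-> a + b}.
  by move=> a b; rewrite /e degM hM vM // fD.
have circG := sb_circ_group B.
apply: (subgroup_free_abelian circG (h := e)) => // a b ab.
have e1 : e sb_one = 0.
  by apply: (addrI (e sb_one)); rewrite -eM (group_left_id circG) addr0.
(* Degree 0 puts this quotient in M; there the value 1 of [h] makes it zero, which is also the unit
   of o. *)
have : e (sb_circ a (sb_inv b)) = 0.
  by rewrite eM ab -eM (group_right_inv circG).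
move=> /f_inj[/deg_inj Sab /(v_inj _ (h_unit _)) /(h_inj _ Sab)].
rewrite -(sb_one_zero B) => /(congr1 (fun x => sb_circ x b)).
rewrite -(group_assoc circG) (group_left_inv circG) (group_right_id circG).
by rewrite (group_left_id circG).
Qed.
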